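(* Let $d\ge 3$ and $\xi\in\mathbb{Z}^d$. Assume that one of the following holds: (a) $\mu>-1$ and $H_0:\mathbb{Z}^d\to\mathbb{R}$ satisfies $0\le H_0\le \overline{H}_0$ in $\mathbb{Z}^d$ and $\lim_{|x|\to+\infty} H_0(x)/\overline{H}_0(x)=1$; (b) $\mu\ge -1$, $H_0:\mathbb{Z}^d\to\mathbb{R}$ satisfies $0\le H_0\le\overline{H}_0$ in $\mathbb{Z}^d$ and, for some $\varepsilon_0\in(0,1)$, $\limsup_{|x|\to+\infty}\frac{(\overline{H}_0(x)-H_0(x))|x|^{\varepsilon_0}}{\overline{H}_0(x)}\in[0,+\infty)$; and, in the case $\mu=-1$, moreover $H_0<\overline{H}_0$ in $\mathbb{Z}^d$. Then the problem $$\mathcal{L}_\mu u=\delta_\xi\ \text{ in }\mathbb{Z}^d,\qquad u\ge 0\ \text{ in }\mathbb{Z}^d$$ has a minimal positive solution (Green kernel) $\Phi_{d,\mu}(\cdot,\xi)$. It is unique among positive solutions satisfying the corresponding upper bound below (the upper bound in (1) under assumption (a), the upper bound in (2) under assumption (b)). Moreover: (1) Under assumption (a), for every $0<\theta<\tau_+-\tau_-$ there exists a constant $C_\theta\ge1$ such that, for sufficiently large $|x-\xi|$, $$C_\theta^{-1}|x-\xi|^{\tau_--\theta}\le \Phi_{d,\mu}(x,\xi)\le C_\theta|x-\xi|^{\tau_-+\theta}.$$ (2) Under assumption (b), there exists a constant $C\ge1$ such that, for sufficiently large $|x-\xi|$, $$C^{-1}|x-\xi|^{\tau_-}\le\Phi_{d,\mu}(x,\xi)\le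 C|x-\xi|^{\tau_-}.$$ (3) Furthermore, if $\mu\ge0$, then $$\Phi_{d,\mu}(x,\xi)\le C(1+|x-\xi|)^{2-d}\quad\text{for } x\in\mathbb{Z}^d,$$ where $C>0$ is independent of $x$ and $\xi$.
   Context: $\mathbb{Z}^d$ is the integer lattice graph with $x\sim y$ iff $\sum_k|x_k-y_k|=1$; $|x|$ is the Euclidean norm; $\Delta u(x)=\sum_{y\sim x}(u(y)-u(x))$. $\Phi_d$ is the fundamental solution of $-\Delta$: $-\Delta\Phi_d=\delta_0$ in $\mathbb{Z}^d$, $\lim_{|x|\to\infty}\Phi_d(x)=0$, where $\delta_\xi$ is the function equal to $1$ at $\xi$ and $0$ elsewhere. The function $\overline{H}_0$ is defined by $\overline{H}_0(x)=-[\Delta\Phi_d^{1/2}(x)]\,\Phi_d^{-1/2}(x)$; it is known that $\overline{H}_0>0$ and $\overline{H}_0(x)=\frac{(d-2)^2}{4}|x|^{-2}+O(|x|^{-3})$ as $|x|\to\infty$. The Hardy operator is $\mathcal{L}_\mu u=-\Delta u+\mu H_0u$. For $\mu\ge-1$, $\tau_\pm=\tau_\pm(\mu)=\frac{2-d}{2}(1\mp\sqrt{1+\mu})$. A minimal positive solution is a positive solution which is pointwise not larger than any other positive solution; no boundary condition at infinity is imposed. *)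

(* Defs.v *)
From HB Require Import structures.
From mathcomp Require Import all_boot all_order all_algebra.
From mathcomp Require Import all_classical all_reals all_analysis.
From mathcomp Require Import zify.

Set Implicit Arguments.
Unset Strict Implicit.
Unset Printing Implicit Defensive.

Import Order.TTheory GRing.Theory Num.Theory.
Import numFieldNormedType.Exports.

Local Open Scope classical_set_scope.
Local Open Scope ring_scope.

Notation lattice d := 'rV[int]_d.

Definition adjacent (d : nat) (x y : lattice d) : bool :=
  \sum_(k < d) `|x 0 k - y 0 k| == 1.

Definition euclid_norm (R : realType) (d : nat) (x : lattice d) : R :=
  Num.sqrt (\sum_(k < d) (x 0 k)%:~R ^+ 2).

Definition at_infinity (R : realType) (d : nat) : set_system (lattice d) :=
  filter_from [set: R] (fun M => [set x | M < euclid_norm R x]).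
Arguments at_infinity : clear implicits.

(* The body of [limf_esup], which cannot be applied as it stands because
   [lattice d] carries no [filteredType] structure. *)
Definition limsup_at_infinity (R : realType) (d : nat)
    (f : lattice d -> R) : \bar R :=
  ereal_inf [set ereal_sup [set (f x)%:E | x in V] | V in at_infinity R d].

Definition laplacian (R : realType) (d : nat) (u : lattice d -> R)
    (x : lattice d) : R :=
  \sum_(y \in [set y | adjacent x y]) (u y - u x).

(* A sum over an infinite support would be 0 by convention; the neighbourhoods
   over which [laplacian] sums are finite. *)
Lemma finite_adjacent (d : nat) (x : lattice d) :
  finite_set [set y | adjacent x y].
Proof.
pose f (s : {ffun 'I_d -> 'I_3}) : lattice d :=
  \row_k (x 0 k + (s k : nat)%:Z - 1).
apply: (@sub_finite_set _ _ (f @` [set: {ffun 'I_d -> 'I_3}])); last first.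
  by apply: finite_image; exact: finite_finset.
move=> y /= /eqP xy1.
have le1 k : `|x 0 k - y 0 k| <= 1.
  rewrite -xy1 (bigD1 k)//= lerDl; apply: sumr_ge0 => i _; exact: normr_ge0.
have ge0 k : 0 <= y 0 k - x 0 k + 1.
  by move: (le1 k); rewrite ler_norml => /andP[_]; lia.
exists [ffun k : 'I_d => inord (absz (y 0 k - x 0 k + 1))] => //.
apply/rowP => k; rewrite mxE ffunE inordK.
  by rewrite gez0_abs//; lia.
by move: (le1 k) (ge0 k); lia.
Qed.

Definition delta (R : realType) (d : nat) (xi x : lattice d) : R :=
  (x == xi)%:R.

Definition fundamental_solution (R : realType) (d : nat)
    (Phi : lattice d -> R) : Prop :=
  (forall x, - laplacian Phi x = delta R 0 x) /\
  Phi x @[x --> at_infinity R d] --> (0 : R).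

(* The potential for which Phi^(1/2) solves the Hardy equation with mu = -1:
   - Delta (Phi^(1/2)) = hardy_potential Phi * Phi^(1/2). *)
Definition hardy_potential (R : realType) (d : nat) (Phi : lattice d -> R)
    (x : lattice d) : R :=
  - laplacian (fun y => Num.sqrt (Phi y)) x * (Num.sqrt (Phi x))^-1.

Definition hardy_operator (R : realType) (d : nat) (mu : R)
    (H0 : lattice d -> R) (u : lattice d -> R) (x : lattice d) : R :=
  - laplacian u x + mu * H0 x * u x.

Definition tau_plus (R : realType) (d : nat) (mu : R) : R :=
  (2 - d%:R) / 2 * (1 - Num.sqrt (1 + mu)).

Definition tau_minus (R : realType) (d : nat) (mu : R) : R :=
  (2 - d%:R) / 2 * (1 + Num.sqrt (1 + mu)).

Definition solution (R : realType) (d : nat) (mu : R) (H0 : lattice d -> R)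
    (xi : lattice d) (u : lattice d -> R) : Prop :=
  (forall x, hardy_operator mu H0 u x = delta R xi x) /\
  (forall x, 0 <= u x).

Definition positive_solution (R : realType) (d : nat) (mu : R)
    (H0 : lattice d -> R) (xi : lattice d) (u : lattice d -> R) : Prop :=
  solution mu H0 xi u /\ (forall x, 0 < u x).

Definition minimal_positive_solution (R : realType) (d : nat) (mu : R)
    (H0 : lattice d -> R) (xi : lattice d) (u : lattice d -> R) : Prop :=
  positive_solution mu H0 xi u /\
  (forall v, positive_solution mu H0 xi v -> forall x, u x <= v x).

Definition assumption_a (R : realType) (d : nat) (Hbar : lattice d -> R)
    (mu : R) (H0 : lattice d -> R) : Prop :=
  [/\ -1 < mu,
      forall x, 0 <= H0 x <= Hbar x &
      H0 x / Hbar x @[x --> at_infinity R d] --> (1 : R)].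

Definition assumption_b (R : realType) (d : nat) (Hbar : lattice d -> R)
    (mu : R) (H0 : lattice d -> R) : Prop :=
  [/\ -1 <= mu,
      forall x, 0 <= H0 x <= Hbar x,
      exists2 eps0 : R, 0 < eps0 < 1 &
        (0 <= limsup_at_infinity (fun x =>
          (Hbar x - H0 x) * euclid_norm R x `^ eps0 / Hbar x)%R < +oo)%E &
      mu = -1 -> forall x, H0 x < Hbar x].

Definition power_upper_bound (R : realType) (d : nat) (xi : lattice d)
    (tau C : R) (u : lattice d -> R) : Prop :=
  exists M : R, forall x, M < euclid_norm R (x - xi) ->
    u x <= C * euclid_norm R (x - xi) `^ tau.

Definition power_lower_bound (R : realType) (d : nat) (xi : lattice d)
    (tau C : R) (u : lattice d -> R) : Prop :=
  exists M : R, forall x, M < euclid_norm R (x - xi) ->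
    C^-1 * euclid_norm R (x - xi) `^ tau <= u x.

Definition upper_bound_a (R : realType) (d : nat) (mu : R) (xi : lattice d)
    (u : lattice d -> R) : Prop :=
  forall theta : R, 0 < theta < tau_plus d mu - tau_minus d mu ->
    exists2 C : R, 1 <= C &
      power_upper_bound xi (tau_minus d mu + theta) C u.

Definition upper_bound_b (R : realType) (d : nat) (mu : R) (xi : lattice d)
    (u : lattice d -> R) : Prop :=
  exists2 C : R, 1 <= C & power_upper_bound xi (tau_minus d mu) C u.

(* Main.v *)
(* The powers of the fundamental solution Phi are approximate solutions of the
   Hardy equation: since Phi is harmonic away from 0 and varies slowly at
   infinity,
     - Delta (Phi^p) = (4 p (1 - p) + O(1/|x|)) Hbar Phi^p,
   so that L_mu (Phi^p) has at infinity the sign of q(p) = 4 p (1 - p) + mu, which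
   vanishes at alpha = (1 + sqrt (1 + mu)) / 2, and Phi^alpha ~ |x|^tau_-.
   Hence Phi^(alpha -+ eta) are a super- and a subsolution under (a), and under (b)
   the errors O(|x|^-eps0) are absorbed by Phi^(alpha + eps) for a small eps > 0.

   The Green kernel is the infimum of all nonnegative supersolutions. Minimality
   turns a supersolution near infinity into an upper bound; the comparison
   principle relative to the global supersolution Phi^(1/2) gives the lower bounds.

   The two facts needed about Phi are Phi ~ |x|^(2-d), by comparison with explicit
   radial barriers, and |Phi(y) - Phi(x)| <= C Phi(x) / |x| for y ~ x, by comparing
   Phi with its reflection across a hyperplane. *)

Require Import Defs.
From mathcomp Require Import all_boot all_order all_algebra.
From mathcomp Require Import all_classical all_reals all_analysis.
From mathcomp Require Import zify ring lra.
Import Order.TTheory GRing.Theory Num.Theory.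
Import numFieldNormedType.Exports.
Local Open Scope classical_set_scope.
Local Open Scope ring_scope.

Set Implicit Arguments.
Unset Strict Implicit.
Unset Printing Implicit Defensive.

(** * The lattice Laplacian *)

(** It is available for the quotient u / Phi^(1/2), because L_mu (Phi^(1/2)) = (Hbar + mu H0)
    Phi^(1/2) >= 0 whenever mu >= -1 and 0 <= H0 <= Hbar. What has to be controlled at infinity is
    therefore size relative to Phi^(1/2), and Phi^p is negligible in this sense exactly when p >
    1/2. The same inequality, strict at the origin, produces the supersolutions with a unit source
    over which the infimum is taken. For mu > -1 one has alpha > 1/2, and a solution obeying the
    upper bound of (a) with a small theta is negligible, so comparison identifies it with the
    kernel. For mu = -1, alpha = 1/2 is exactly the threshold: Phi^alpha is not negligible. Hence
    uniqueness under (b) goes through the lower bound on the kernel and its minimality, and that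
    lower bound is itself a limit of bounds with exponents above alpha. *)

Definition nbr (d : nat) (x : lattice d) (i : 'I_d * bool) : lattice d :=
  x + (-1) ^+ i.2 *: delta_mx 0 i.1.

Lemma nbrE (d : nat) (x : lattice d) (i : 'I_d * bool) (j : 'I_d) :
  nbr x i 0 j = x 0 j + (if j == i.1 then (-1) ^+ i.2 else 0).
Proof.
rewrite !mxE eqxx /=; case: eqP => _; first by rewrite mulr1.
by rewrite mulr0.
Qed.

Lemma nbr_adjacent (d : nat) (x : lattice d) (i : 'I_d * bool) :
  Defs.adjacent x (nbr x i).
Proof.
rewrite /Defs.adjacent (bigD1 i.1)//= big1 => [|j ji].
  by rewrite nbrE eqxx; case: i.2 => /=; rewrite ?expr1 ?expr0; lia.
by rewrite nbrE (negbTE ji) addr0 subrr normr0.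
Qed.

Lemma nbr_inj (d : nat) (x : lattice d) : injective (nbr x).
Proof.
move=> [i b] [j c] /rowP e.
have := e i; rewrite !nbrE /= eqxx.
case: eqP => [<-|_]; first by case: b c {e} => [] [] //=; lia.
by case: b {e} => /=; lia.
Qed.

Lemma nbr_opp (d : nat) (x : lattice d) k b : nbr (nbr x (k, b)) (k, ~~ b) = x.
Proof.
apply/rowP => j; rewrite !nbrE /=; case: eqP => _; last by rewrite !addr0.
by case: b => /=; lia.
Qed.

Lemma adjacent_nbr (d : nat) (x y : lattice d) :
  Defs.adjacent x y -> exists i, y = nbr x i.
Proof.
move=> /eqP xy1.
have [k xyk] : exists k, x 0 k != y 0 k.
  apply/existsP; rewrite -negb_forall; apply/negP => /forallP h.
  by move: xy1; rewrite big1// => k _; rewrite (eqP (h k)) subrr normr0.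
have [h1 h2] : `|x 0 k - y 0 k| = 1 /\ forall j, j != k -> x 0 j = y 0 j.
  move: xy1; rewrite (bigD1 k)//=.
  set S := (X in _ + X = _).
  have S0 : 0 <= S by apply: sumr_ge0 => j _; exact: normr_ge0.
  move=> e; have S00 : S = 0 by lia.
  split; first by lia.
  move=> j jk; have /eqP := S00.
  rewrite psumr_eq0 => [/allP/(_ j)|i _]; last exact: normr_ge0.
  by rewrite mem_index_enum jk /= normr_eq0 subr_eq0 => /(_ isT)/eqP.
exists (k, (y 0 k < x 0 k)); apply/rowP => j; rewrite nbrE /=.
case: eqP => [->|/eqP /h2 ->]; last by rewrite addr0.
by case: ltP => /=; lia.
Qed.

Section laplacian_theory.
Context (R : realType) (d : nat).
Implicit Types (u v : lattice d -> R) (x y : lattice d).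

(** Indexing the neighbours by a coordinate and a sign, [true] being the negative direction, turns
    the sum over a set into a sum over a finite type. *)
Lemma laplacianE u x : laplacian u x = \sum_i (u (nbr x i) - u x).
Proof.
rewrite /laplacian.
have -> : [set y | Defs.adjacent x y] = nbr x @` [set: 'I_d * bool].
  apply/seteqP; split => y /=.
    by move=> /adjacent_nbr[i ->]; exists i.
  by move=> [i _ <-]; exact: nbr_adjacent.
rewrite (@reindex_fsbig _ _ _ _ _ (nbr x) setT) /=; last first.
  by split => // i j _ _; exact: nbr_inj.
rewrite [RHS]fsbig_seq; last exact: index_enum_uniq.
by apply: eq_fsbigl; apply/seteqP; split=> i _ //=; rewrite mem_index_enum.
Qed.

Lemma laplacianE_sum u x :
  laplacian u x = \sum_i u (nbr x i) - (d * 2)%:R * u x.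
Proof.
by rewrite laplacianE big_split /= sumr_const card_prod card_ord card_bool
  mulNrn mulr_natl.
Qed.

Lemma laplacianD u v x :
  laplacian (u \+ v) x = laplacian u x + laplacian v x.
Proof.
by rewrite !laplacianE -big_split /=; apply: eq_bigr => i _; rewrite opprD addrACA.
Qed.

Lemma laplacianZ a u x : laplacian (fun y => a * u y) x = a * laplacian u x.
Proof. by rewrite !laplacianE mulr_sumr; apply: eq_bigr => i _; rewrite mulrBr. Qed.

Lemma laplacian_shift u a x :
  laplacian (fun y => u (y - a)) x = laplacian u (x - a).
Proof.
rewrite !laplacianE; apply: eq_bigr => i _; congr (u _ - _).
by rewrite /nbr addrAC.
Qed.

End laplacian_theory.

(** Connectedness of the lattice: from [x != a] some step decreases the l1 distance to [a]. *)
Lemma lattice_ind (d : nat) (P : lattice d -> Prop) (a : lattice d) :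
  P a -> (forall x i, P x -> P (nbr x i)) -> forall x, P x.
Proof.
move=> Pa Pn x.
have [n] := ubnP (\sum_k `|(x 0%R k - a 0%R k)%R|)%N.
elim: n x => // n IH x; rewrite ltnS => xn.
have [->//|xa] := eqVneq x a.
have [k xk] : exists k, x 0 k != a 0 k.
  apply/existsP; rewrite -negb_forall; apply: contra xa => /forallP h.
  by apply/eqP/rowP => k; exact/eqP.
pose b := (a 0 k < x 0 k).
rewrite -(nbr_opp x k b); apply/Pn/IH.
apply: leq_trans xn; rewrite (bigD1 k)//= [ltnRHS](bigD1 k)//= -addSn.
apply: leq_add.
  rewrite nbrE /= eqxx /b; case: ltP xk => /=; lia.
by apply: leq_sum => j jk; rewrite nbrE /= (negbTE jk) addr0.
Qed.

(** * Euclidean norm on the lattice *)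

Section euclid_norm_theory.
Context (R : realType) (d : nat).
Implicit Types (x y : lattice d).
Local Notation N := (euclid_norm R).

Lemma euclid_norm_sqr x : N x ^+ 2 = \sum_(k < d) (x 0 k)%:~R ^+ 2.
Proof. by rewrite sqr_sqrtr// sumr_ge0// => k _; rewrite sqr_ge0. Qed.

Lemma euclid_norm_ge0 x : 0 <= N x.
Proof. exact: sqrtr_ge0. Qed.

Lemma euclid_norm0 : N (0 : lattice d) = 0.
Proof.
by rewrite /euclid_norm big1 ?sqrtr0// => k _; rewrite mxE expr0n.
Qed.

Lemma euclid_normN x : N (- x) = N x.
Proof.
by congr Num.sqrt; apply: eq_bigr => k _; rewrite mxE mulrNz sqrrN.
Qed.

Lemma euclid_normB x y : N (x - y) = N (y - x).
Proof. by rewrite -euclid_normN opprB. Qed.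

Lemma coord_le_euclid_norm x k : `|(x 0 k)%:~R| <= N x.
Proof.
rewrite -sqrtr_sqr; apply: ler_wsqrtr.
by rewrite (bigD1 k)//= lerDl sumr_ge0// => j _; rewrite sqr_ge0.
Qed.

(** Cauchy-Schwarz is read off the sum of the squares (a x_k - b y_k)^2 with a = |y| and b = |x|; if
    a norm vanishes, other weights force [p ^+ 2 <= 0]. *)
Lemma euclid_norm_triangle x y : N (x + y) <= N x + N y.
Proof.
have S2 := euclid_norm_sqr.
pose p := \sum_(k < d) ((x 0 k)%:~R * (y 0 k)%:~R) : R.
have cs (a b : R) : 2 * a * b * p <= a ^+ 2 * N x ^+ 2 + b ^+ 2 * N y ^+ 2.
  rewrite -subr_ge0 !S2 !mulr_sumr -big_split -sumrB /=.
  apply: sumr_ge0 => k _.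
  rewrite (_ : _ - _ = (a * (x 0 k)%:~R - b * (y 0 k)%:~R) ^+ 2) ?sqr_ge0//.
  by ring.
have pN : p <= N x * N y.
  have := euclid_norm_ge0 x; rewrite le_eqVlt => /predU1P[x0|x0].
    have := cs (N y ^+ 2 + 1) p; rewrite -x0 expr0n mulr0 add0r mul0r.
    have := sqr_ge0 (N y); set n := _ ^+ 2 => n0 h.
    by have : p ^+ 2 <= 0; nra.
  have := euclid_norm_ge0 y; rewrite le_eqVlt => /predU1P[y0|y0].
    have := cs p (N x ^+ 2 + 1); rewrite -y0 expr0n !mulr0 addr0.
    have := sqr_ge0 (N x); set n := _ ^+ 2 => n0 h.
    by have : p ^+ 2 <= 0; nra.
  have := cs (N y) (N x).
  rewrite (_ : _ + _ = 2 * N y * N x * (N x * N y)); last by ring.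
  by rewrite ler_pM2l// !mulr_gt0.
rewrite -(ler_pXn2r (_ : 0 < 2)%N) ?nnegrE ?addr_ge0 ?euclid_norm_ge0//.
rewrite sqrrD S2.
have -> : \sum_(k < d) (((x + y) 0 k)%:~R : R) ^+ 2 =
    N x ^+ 2 + p *+ 2 + N y ^+ 2.
  rewrite !S2 -mulr_natr mulr_suml -!big_split /=.
  by apply: eq_bigr => k _; rewrite mxE intrD; ring.
by rewrite lerD2r lerD2l ler_wMn2r.
Qed.

Lemma euclid_norm_triangleB x y : N x <= N (x - y) + N y.
Proof. by rewrite -{1}(subrK y x); exact: euclid_norm_triangle. Qed.

Lemma euclid_norm_le_sum x : N x <= \sum_(k < d) `|(x 0 k)%:~R|.
Proof.
have S0 : 0 <= \sum_(k < d) `|(x 0 k)%:~R : R| by apply: sumr_ge0.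
rewrite -(ler_pXn2r (_ : 0 < 2)%N) ?nnegrE ?euclid_norm_ge0//.
rewrite euclid_norm_sqr expr2 mulr_suml; apply: ler_sum => k _.
rewrite -normr_id -real_normK ?num_real// expr2 normr_id ler_wpM2l//.
by rewrite (bigD1 k)//= lerDl sumr_ge0.
Qed.

Lemma euclid_norm_nbr x i : N (nbr x i - x) = 1.
Proof.
apply/eqP; rewrite -sqrp_eq1 ?euclid_norm_ge0// euclid_norm_sqr.
rewrite (bigD1 i.1)//= big1 ?addr0 => [|j ji]; rewrite mxE nbrE mxE.
  rewrite eqxx addrAC subrr add0r; case: i.2; rewrite ?expr0 ?expr1 ?mulrN1z.
    by rewrite sqrrN expr1n.
  by rewrite expr1n.
by rewrite (negbTE ji) addr0 subrr expr0n.
Qed.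

Lemma euclid_norm_nbr_ge x i : N x <= N (nbr x i) + 1.
Proof.
by rewrite -(euclid_norm_nbr x i) euclid_normB addrC; exact: euclid_norm_triangleB.
Qed.

Lemma finite_ball (M : R) : finite_set [set x : lattice d | N x <= M].
Proof.
have [n Mn] : exists n : nat, M <= n%:R.
  by exists (Num.truncn `|M|).+1; apply: le_trans (ler_norm _) (ltW _); exact: truncnS_gt.
pose f (s : {ffun 'I_d -> 'I_(n + n).+1}) : lattice d :=
  \row_k ((s k : nat)%:Z - n%:Z).
apply: (@sub_finite_set _ _ (f @` [set: {ffun 'I_d -> 'I_(n + n).+1}])); last first.
  by apply: finite_image; exact: finite_finset.
move=> x /= xM.
have xn k : `|x 0 k| <= n%:Z.
  rewrite -(ler_int R) intr_norm.
  by apply: le_trans (coord_le_euclid_norm x k) _; exact: le_trans Mn.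
exists [ffun k : 'I_d => inord (absz (x 0 k + n%:Z))] => //.
apply/rowP => k; rewrite mxE ffunE inordK; have := xn k; lia.
Qed.

End euclid_norm_theory.

Lemma finite_argmin (R : realType) (T : choiceType) (A : set T) (f : T -> R) :
  finite_set A -> A !=set0 -> exists2 p, A p & forall x, A x -> f p <= f x.
Proof.
move=> /finite_seqP[s ->] [x0 /= x0s].
elim: s x0 x0s => // a s IH x0 _.
case: s IH => [|b s] IH.
  by exists a => /=; rewrite ?inE// => x /=; rewrite inE => /eqP ->.
have [|p /= ps pmin] := IH b; first by rewrite inE eqxx.
have [fap|fpa] := leP (f a) (f p).
  exists a => /=; first by rewrite inE eqxx.
  move=> x; rewrite inE => /predU1P[->//|/pmin]; exact: le_trans.
exists p => /=; first by rewrite inE ps orbT.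
by move=> x; rewrite inE => /predU1P[->|/pmin//]; exact: ltW.
Qed.

Lemma finite_bound (R : realType) (T : choiceType) (A : set T) (f : T -> R) :
  finite_set A -> exists2 K, 0 < K & forall x, A x -> f x <= K.
Proof.
move=> Afin; have [->|/set0P A0] := eqVneq A set0; first by exists 1.
have [p _ pmin] := finite_argmin (fun x => - f x) Afin A0.
exists (`|f p| + 1); first by rewrite ltr_pwDr.
move=> x /pmin; rewrite lerN2 => fx; apply: le_trans fx _.
by apply: le_trans (ler_norm _) _; rewrite lerDl.
Qed.

(** * Neighbourhoods of infinity *)

Section at_infinity_theory.
Context (R : realType) (d : nat).
Local Notation N := (euclid_norm R).

Global Instance at_infinity_filter : Filter (at_infinity R d).
Proof.
apply: filter_from_filter; first by exists 0.
move=> a b _ _; exists (Num.max a b) => // x /=.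
by rewrite gt_max => /andP[].
Qed.

Lemma near_infinity_gt (M : R) : \forall x \near at_infinity R d, M < N x.
Proof. by exists M. Qed.

Lemma near_infinityP (P : set (lattice d)) :
  (\forall x \near at_infinity R d, P x) <-> exists M, forall x, M < N x -> P x.
Proof. by split => [[M _ h]|[M h]]; exists M. Qed.

Lemma near_infinity_shift (P : set (lattice d)) (a : lattice d) :
  (\forall x \near at_infinity R d, P x) ->
  \forall x \near at_infinity R d, P (x - a).
Proof.
move=> [M _ h]; exists (M + N a) => // x /= Mx; apply: h => /=.
by rewrite -(ltrD2r (N a)); apply: lt_le_trans Mx (euclid_norm_triangleB _ _ _).
Qed.

End at_infinity_theory.

(** * Comparison principle and Green function *)

(** A general potential serves both the Hardy operator, which is the case [V = mu * H0] by
    conversion, and [- laplacian], the case [V = 0]. *)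
Definition schrodinger (R : realType) (d : nat) (V u : lattice d -> R)
  (x : lattice d) : R := - laplacian u x + V x * u x.

Definition supersolution (R : realType) (d : nat) (V : lattice d -> R)
    (xi : lattice d) (v : lattice d -> R) : Prop :=
  (forall x, 0 <= v x) /\ (forall x, delta R xi x <= schrodinger V v x).

(** A real infimum, equal to 0 by convention when there is no supersolution. *)
Definition green (R : realType) (d : nat) (V : lattice d -> R)
    (x xi : lattice d) : R :=
  inf [set v x | v in supersolution V xi].

Section schrodinger_theory.
Context (R : realType) (d : nat) (V : lattice d -> R).
Implicit Types (u v s F : lattice d -> R) (x y xi : lattice d).
Local Notation N := (euclid_norm R).
Local Notation L := (schrodinger V).

Lemma schrodingerE u x :
  L u x = ((d * 2)%:R + V x) * u x - \sum_i u (nbr x i).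
Proof. by rewrite /schrodinger laplacianE_sum; ring. Qed.

Lemma schrodinger_linear a u v x :
  L (fun y => a * u y + v y) x = a * L u x + L v x.
Proof.
rewrite !schrodingerE big_split /= -mulr_sumr; ring.
Qed.

Lemma schrodingerZ a u x : L (fun y => a * u y) x = a * L u x.
Proof. by rewrite !schrodingerE -mulr_sumr; ring. Qed.

(** The neighbours enter [L] with negative coefficients. This lets a minimum inherit the
    supersolution inequality from whichever function attains it. *)
Lemma schrodinger_le_nbr u v x : u x = v x ->
  (forall i, v (nbr x i) <= u (nbr x i)) -> L u x <= L v x.
Proof.
by move=> uv h; rewrite !schrodingerE uv lerD2l lerN2; apply: ler_sum.
Qed.

(* Strong minimum principle for [F / s]: a negative minimum spreads to all the
   neighbours, which is impossible at a minimizer with largest coordinate. *)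
Lemma comparison s F : (0 < d)%N ->
  (forall x, 0 < s x) -> (forall x, 0 <= L s x) ->
  (forall x, F x < 0 -> 0 <= L F x) ->
  (forall e, 0 < e -> \forall x \near at_infinity R d, - (e * s x) <= F x) ->
  forall x, 0 <= F x.
Proof.
move=> d0 s0 Ls LF Foo x0; rewrite leNgt; apply/negP => Fx0.
pose q x := F x / s x.
have qx0 : q x0 < 0 by rewrite /q pmulr_llt0 ?invr_gt0.
(* With [e = - q x0 / 2] the hypothesis at infinity gives [q >= q x0 / 2 > q x0] outside a ball, so
   the minimum of [q] is attained. *)
have Afin : finite_set [set x | q x <= q x0].
  have /Foo[M _ hM] : 0 < - q x0 / 2 by lra.
  apply: (@sub_finite_set _ _ [set x | N x <= M] _ (@finite_ball R d M)) => x /= qx.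
  rewrite leNgt; apply/negP => /hM /=.
  by rewrite leNgt => /negP; apply; rewrite -mulNr -ltr_pdivrMr// -/(q x); lra.
have [p qp pmin] : exists2 p, q p < 0 & forall x, q p <= q x.
  have [|p /= pA pmin] := finite_argmin q Afin; first by exists x0 => /=.
  exists p; first exact: le_lt_trans pA qx0.
  by move=> x; have [/pmin//|/ltW] := leP (q x) (q x0); exact: le_trans.
have Bfin : finite_set [set x | q x = q p].
  by apply: (@sub_finite_set _ _ [set x | q x <= q x0] _ Afin) => x /= ->.
pose k := Ordinal d0.
have [|y /= qy ymax] := finite_argmin (fun x => - (x 0 k)%:~R : R) Bfin.
  by exists p.
have /ymax : q (nbr y (k, false)) = q p; last first.
  by rewrite lerN2 ler_int nbrE eqxx /= expr0 gerDl ler10.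
(* [g] is nonnegative, vanishes at [y] and satisfies [0 <= L g y], so it vanishes at all neighbours
   of [y]. *)
pose g x := - q p * s x + F x.
have g0 x : 0 <= g x.
  by rewrite /g addrC mulNr subr_ge0 -ler_pdivlMr//; exact: pmin.
have gy : g y = 0 by rewrite /g -qy /q mulNr divfK ?addNr// gt_eqF.
have Fy : F y < 0 by move: qp; rewrite -qy /q pmulr_llt0// invr_gt0.
have : 0 <= L g y.
  by rewrite schrodinger_linear addr_ge0 ?LF// mulr_ge0// oppr_ge0 ltW.
rewrite schrodingerE gy mulr0 sub0r oppr_ge0 => sg.
have /eqP : \sum_i g (nbr y i) = 0.
  by apply/le_anti; rewrite sg sumr_ge0.
rewrite psumr_eq0// => /allP/(_ (k, false)); rewrite mem_index_enum => /(_ isT).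
rewrite /= /g addrC mulNr subr_eq0 => /eqP Fs.
by rewrite {1}/q Fs mulfK// gt_eqF.
Qed.

(** The comparison principle for [v - u], which can be negative only outside the ball; since
    [0 <= v], only [u] has to be negligible at infinity. *)
Lemma exterior_comparison s u v r : (0 < d)%N ->
  (forall x, 0 < s x) -> (forall x, 0 <= L s x) ->
  (forall x, N x <= r -> u x <= v x) ->
  (forall x, r < N x -> L u x <= L v x) ->
  (forall x, 0 <= v x) ->
  (forall e, 0 < e -> \forall x \near at_infinity R d, u x <= e * s x) ->
  forall x, u x <= v x.
Proof.
move=> d0 s0 Ls uv Luv v0 uoo x.
suff : 0 <= -1 * u x + v x by rewrite mulN1r addrC subr_ge0.
apply: (comparison (s := s) (F := fun x => -1 * u x + v x)) => // {}x.
  move=> uvx; rewrite schrodinger_linear mulN1r addrC subr_ge0; apply: Luv.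
  rewrite ltNge; apply/negP => /uv; move: uvx; lra.
move=> /uoo; apply: filterS => y uy; have := v0 y; lra.
Qed.

(** Balls are finite, so some multiple of [w] dominates [u] near the inner boundary. Inside the ball
    [w] is replaced by 1, to have a positive function everywhere. *)
Lemma exterior_domination s u w r : (0 < d)%N ->
  (forall x, 0 < s x) -> (forall x, 0 <= L s x) ->
  (forall x, r < N x -> 0 < w x) -> (forall x, r < N x -> 0 <= L w x) ->
  (forall x, r < N x -> L u x <= 0) ->
  (forall e, 0 < e -> \forall x \near at_infinity R d, u x <= e * s x) ->
  exists2 K, 0 < K & forall x, r < N x -> u x <= K * w x.
Proof.
move=> d0 s0 Ls w0 Lw Lu uoo.
pose w' x := if N x <= r then 1 else w x.
have w'0 x : 0 < w' x.
  by rewrite /w'; have [xr|rx] := leP (N x) r; [exact: ltr01|exact: w0].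
have w'E x : r < N x -> w' x = w x by rewrite /w' leNgt => ->.
(* The radius [r + 1] ensures that all neighbours of an outer point lie where [w' = w]. *)
have [K K0 hK] := finite_bound (fun x => u x / w' x) (@finite_ball R d (r + 1)).
exists K => // x rx; rewrite -w'E//.
apply: (@exterior_comparison s u (fun x => K * w' x) (r + 1)) => //.
- by move=> y yr; rewrite -ler_pdivrMr//; exact: hK.
- move=> y ry; apply: (@le_trans _ _ 0); first by apply: Lu; lra.
  rewrite schrodingerZ; apply: mulr_ge0; first exact: ltW.
  apply: (@le_trans _ _ (L w y)); first by apply: Lw; lra.
  apply: schrodinger_le_nbr => [|i]; first by rewrite w'E//; lra.
  by rewrite w'E//; have := euclid_norm_nbr_ge R y i; lra.
- by move=> y; rewrite mulr_ge0// ltW.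
Qed.

(** The diagonal term has to dominate a positive sum over the neighbours, even where [V] is
    negative. *)
Lemma supersolution_coef_gt0 s : (forall x, 0 < s x) -> (0 < d)%N ->
  (forall x, 0 <= L s x) -> forall x, 0 < (d * 2)%:R + V x.
Proof.
move=> s0 d0 Ls x.
have S0 : 0 < \sum_i s (nbr x i).
  rewrite (bigD1 (Ordinal d0, true))//= ltr_pwDl ?sumr_ge0// => i _; exact: ltW.
have := Ls x; rewrite schrodingerE subr_ge0 => /(lt_le_trans S0).
by rewrite pmulr_lgt0.
Qed.

Section green.
Hypothesis d0 : (0 < d)%N.
Hypothesis coef_gt0 : forall x, 0 < (d * 2)%:R + V x.

Lemma green_ge0 xi x : 0 <= green V x xi.
Proof.
rewrite /green; set S := (X in inf X).
have [->|/set0P S0] := eqVneq S set0; first by rewrite inf0.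
by apply: lb_le_inf => // _ /= [v [v0 _] <-].
Qed.

Lemma green_le xi v : supersolution V xi v -> forall x, green V x xi <= v x.
Proof.
move=> vS x; apply: ge_inf; last by exists v.
by exists 0 => _ /= [w [w0 _] <-].
Qed.

(* Knaster-Tarski: the infimum of the supersolutions is a fixed point of the
   monotone map [u |-> (sum_(y ~ x) u y + delta) / (2 d + V x)]. *)
Lemma green_solves xi : (exists v, supersolution V xi v) ->
  forall x, L (green V ^~ xi) x = delta R xi x.
Proof.
move=> [v0 v0S].
pose G := green V ^~ xi.
pose T u x := (\sum_i u (nbr x i) + delta R xi x) / ((d * 2)%:R + V x).
have TP u x : (delta R xi x <= L u x) = (T u x <= u x).
  rewrite /T ler_pdivrMr ?coef_gt0// schrodingerE.
  by rewrite lerBrDr addrC [u x * _]mulrC.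
have Tmono u v : (forall x, u x <= v x) -> forall x, T u x <= T v x.
  move=> uv x; rewrite /T ler_pM2r ?invr_gt0//.
  by rewrite lerD2r; apply: ler_sum.
have TG x : T G x <= G x.
  apply: lb_le_inf; first by exists (v0 x), v0.
  move=> _ /= [v vS <-]; have [_ Lv] := vS.
  apply: (@le_trans _ _ (T v x)); last by rewrite -TP.
  by apply: Tmono => y; exact: green_le.
have TG0 x : 0 <= T G x.
  rewrite /T divr_ge0//; last exact: ltW.
  by rewrite addr_ge0 ?ler0n// sumr_ge0// => i _; exact: green_ge0.
(* By monotonicity [T (T G) <= T G], so [T G] is one of the supersolutions. *)
have GT x : G x <= T G x.
  apply: green_le; split => // y; rewrite TP; exact: Tmono.
move=> x; rewrite -/G schrodingerE.
have -> : G x = T G x by apply/le_anti; rewrite GT TG.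
rewrite /T mulrC divfK; last by rewrite gt_eqF.
by rewrite addrAC subrr add0r.
Qed.

(** The source makes [v xi] positive, and a positive value forces positive values at the
    neighbours. *)
Lemma supersolution_gt0 xi v : supersolution V xi v -> forall x, 0 < v x.
Proof.
move=> [v0 Lv].
have h x : delta R xi x + \sum_i v (nbr x i) <= ((d * 2)%:R + V x) * v x.
  by have := Lv x; rewrite schrodingerE lerBrDr.
apply: (lattice_ind (a := xi)).
  rewrite -(pmulr_rgt0 (v xi) (coef_gt0 xi)); apply: lt_le_trans (h xi).
  by rewrite /delta eqxx ltr_pwDl// sumr_ge0.
move=> x [k b] vx; rewrite -(pmulr_rgt0 _ (coef_gt0 (nbr x (k, b)))).
apply: lt_le_trans (h _).
rewrite ltr_wpDl ?ler0n//.
by rewrite (bigD1 (k, ~~ b))//= nbr_opp ltr_pwDl// sumr_ge0.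
Qed.

Lemma green_supersolution xi : (exists v, supersolution V xi v) ->
  supersolution V xi (green V ^~ xi).
Proof.
by move=> ex; split => x; [exact: green_ge0|rewrite green_solves].
Qed.

(* [min G (K w)] is again a supersolution, so minimality of [G] gives
   [G <= K w]. *)
Lemma green_upper xi w r : (exists v, supersolution V xi v) -> N xi <= r ->
  (forall x, r < N x -> 0 < w x) -> (forall x, r < N x -> 0 <= L w x) ->
  exists2 K, 0 < K & forall x, r < N x -> green V x xi <= K * w x.
Proof.
move=> ex xir w0 Lw; pose G := green V ^~ xi.
pose w' x := if N x <= r then 1 else w x.
have w'0 x : 0 < w' x.
  by rewrite /w'; have [xr|rx] := leP (N x) r; [exact: ltr01|exact: w0].
(* On this larger ball the minimum is [G], so [K * w'] can be the strict minimum only at points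
   whose neighbours lie where [w' = w]. *)
have [K K0 hK] := finite_bound (fun x => G x / w' x) (@finite_ball R d (r + 2)).
have KG x : N x <= r + 2 -> G x <= K * w' x.
  by move=> xr; rewrite -ler_pdivrMr//; exact: hK.
have w'E x : r < N x -> w' x = w x by rewrite /w' leNgt => ->.
exists K => // x rx; rewrite -w'E//.
pose v y := Num.min (G y) (K * w' y).
suff vS : supersolution V xi v.
  by apply: le_trans (green_le vS x) _; rewrite /v ge_min lexx orbT.
split=> y; first by rewrite /v le_min green_ge0 mulr_ge0// ltW.
have vG : G y <= K * w' y -> delta R xi y <= L v y.
  move=> GK; rewrite -(green_solves ex); apply: schrodinger_le_nbr => [|i].
    by rewrite /v; move/min_idPl : GK.
  by rewrite /v ge_min lexx.
have [/KG/vG//|ry] := leP (N y) (r + 2).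
have [/vG//|GK] := leP (G y) (K * w' y).
rewrite /delta (_ : y == xi = false); last first.
  by apply/eqP => yxi; move: ry xir; rewrite yxi; lra.
apply: (@le_trans _ _ (L (fun y => K * w y) y)).
  by rewrite schrodingerZ; apply: mulr_ge0; [exact: ltW|apply: Lw; lra].
apply: schrodinger_le_nbr => [|i].
  rewrite /v w'E ?(min_idPr _)//; last lra.
  by rewrite -w'E ?ltW//; lra.
rewrite /v w'E ?ge_min ?lexx ?orbT//.
by have := euclid_norm_nbr_ge R y i; lra.
Qed.

End green.

Lemma schrodinger_delta x y : L (delta R x) y =
  if y == x then (d * 2)%:R + V x else - \sum_i delta R x (nbr y i).
Proof.
rewrite schrodingerE /delta; case: eqP => [->|_]; last by rewrite mulr0 sub0r.
rewrite mulr1 big1 ?subr0// => i _; rewrite (_ : _ == _ = false)//.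
apply/eqP => /rowP/(_ i.1); rewrite nbrE eqxx.
by case: i.2 => /=; lia.
Qed.

(** Lowering [s] at [x] by a small [e] raises [L s] by [e] at each neighbour of [x], which carries
    strictness one step further. *)
Lemma strict_supersolution_spread z :
  (exists s, [/\ forall y, 0 < s y, forall y, 0 <= L s y & 0 < L s z]) ->
  forall x,
    exists s, [/\ forall y, 0 < s y, forall y, 0 <= L s y & 0 < L s x].
Proof.
move=> hz; apply: (lattice_ind hz) => x [k b] [s [s0 Ls Lsx]].
pose c := (d * 2)%:R + V x.
(* The first bound keeps the function positive at [x], the second keeps [L] nonnegative there. *)
pose e := Num.min (s x / 2) (L s x / (1 + `|c|)).
have c1 : 0 < 1 + `|c| by rewrite ltr_pwDl.
have e0 : 0 < e by rewrite lt_min !divr_gt0.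
exists (fun y => - e * delta R x y + s y).
have Ld y : y != x -> L (delta R x) y <= 0.
  move=> yx; rewrite schrodinger_delta (negbTE yx) oppr_le0.
  by rewrite sumr_ge0// => i _; exact: ler0n.
split => [y|y|].
- rewrite /delta; case: eqP => [->|_]; last by rewrite mulr0 add0r.
  rewrite mulr1 addrC subr_gt0 gt_min; apply/orP; left.
  by have := s0 x; lra.
- rewrite schrodinger_linear mulNr addrC subr_ge0.
  have [->|yx] := eqVneq y x; last first.
    by apply: le_trans (Ls y); rewrite pmulr_rle0// Ld.
  rewrite schrodinger_delta eqxx -/c.
  have : e <= L s x / (1 + `|c|) by rewrite ge_min lexx orbT.
  rewrite ler_pdivlMr//; have := ler_norm c; nra.
- rewrite schrodinger_linear mulNr addrC subr_gt0.
  apply: lt_le_trans (Ls _); rewrite pmulr_rlt0// schrodinger_delta.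
  case: eqP => [/rowP/(_ k)|_].
    by rewrite nbrE /= eqxx; case: b => /=; lia.
  rewrite oppr_lt0 (bigD1 (k, ~~ b))//= nbr_opp ltr_pwDl//.
    by rewrite /delta eqxx.
  by rewrite sumr_ge0// => i _; exact: ler0n.
Qed.

Lemma exists_supersolution z s xi :
  (forall y, 0 < s y) -> (forall y, 0 <= L s y) -> 0 < L s z ->
  exists v, supersolution V xi v.
Proof.
move=> s0 Ls Lsz.
have [|v [v0 Lv Lvxi]] := @strict_supersolution_spread z _ xi.
  by exists s.
exists (fun y => (L v xi)^-1 * v y); split => y.
  by rewrite mulr_ge0 ?invr_ge0// ltW.
rewrite schrodingerZ /delta; case: eqP => [->|_].
  by rewrite mulVf// gt_eqF.
by rewrite mulr_ge0// invr_ge0 ltW.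
Qed.

End schrodinger_theory.

(** * Taylor expansion of real powers *)

Lemma primitive_bound (R : realType) (f df : R -> R) (C r : R) (n : nat) :
  0 <= C -> f 0 = 0 ->
  (forall t : R, `|t| <= r -> is_derive t 1 f (df t)) ->
  (forall t, `|t| <= r -> `|df t| <= C * `|t| ^+ n) ->
  forall t, `|t| <= r -> `|f t| <= C * `|t| ^+ n.+1.
Proof.
move=> C0 f0 fdf dfC t tr.
(* Mean value theorem between 0 and [t], treated separately for each sign of [t]. *)
suff [c ct ->] : exists2 c, `|c| <= `|t| & f t = df c * t.
  rewrite normrM exprSr mulrA ler_wpM2r//.
  by apply: le_trans (dfC c (le_trans ct tr)) _; rewrite ler_wpM2l ?lerXn2r ?nnegrE.
have cont (a b : R) : (forall x, x \in `[a, b] -> `|x| <= r) ->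
    {within `[a, b], continuous f}.
  move=> h; apply: derivable_within_continuous => x /h /fdf fd.
  exact: ex_derive.
have [t0|t0|->] := ltgtP t 0; last by exists 0; rewrite ?normr0 ?mulr0.
  have tE : `|t| = - t by rewrite ltr0_norm.
  have h x : t <= x -> x <= 0 -> `|x| <= `|t|.
    by move=> tx x0; rewrite tE ler0_norm// lerN2.
  have [x||c] := @MVT R f df t 0 t0.
  - by rewrite in_itv /= => /andP[xt x0]; apply: fdf;
    apply: le_trans (h _ _ _) tr; exact: ltW.
  - by apply: cont => x; rewrite in_itv /= => /andP[xt x0]; apply: le_trans (h _ _ _) tr.
  - rewrite in_itv /= => /andP[ct c0]; rewrite f0 sub0r sub0r mulrN => /oppr_inj ->.
    by exists c => //; apply: h; exact: ltW.
have tE : `|t| = t by rewrite gtr0_norm.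
have h x : 0 <= x -> x <= t -> `|x| <= `|t| by move=> x0 xt; rewrite tE ger0_norm.
have [x||c] := @MVT R f df 0 t t0.
- by rewrite in_itv /= => /andP[x0 xt]; apply: fdf;
    apply: le_trans (h _ _ _) tr; exact: ltW.
- by apply: cont => x; rewrite in_itv /= => /andP[x0 xt]; apply: le_trans (h _ _ _) tr.
- rewrite in_itv /= => /andP[c0 ct]; rewrite f0 !subr0 => ->.
  by exists c => //; apply: h; exact: ltW.
Qed.

(** On this range of [t] one has |ln (1 + t)| <= 1. *)
Lemma powR_bound (R : realType) (Q q t : R) : `|q| <= Q -> `|t| <= 2^-1 ->
  (1 + t) `^ q <= expR Q.
Proof.
move=> qQ; rewrite ler_norml => /andP[t1 t2].
have t0 : 0 < 1 + t by lra.
rewrite /powR gt_eqF// ler_expR.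
suff : `|ln (1 + t)| <= 1.
  move=> l1; apply: le_trans (ler_norm _) _; rewrite normrM -[Q]mulr1.
  by rewrite ler_pM.
have ln1 : ln (1 + t) <= 1 by apply: le_trans (le_ln1Dx _) _; lra.
have lnV1 : ln (1 + t)^-1 <= 1.
  have t2' : (1 + t)^-1 <= 2 by rewrite invf_ple ?posrE//; lra.
  have := @le_ln1Dx R ((1 + t)^-1 - 1); rewrite addrCA subrr addr0.
  have : 0 < (1 + t)^-1 by rewrite invr_gt0.
  move=> ? h; apply: le_trans (h _) _; lra.
by rewrite ler_norml ln1 andbT lerNl -lnV// posrE.
Qed.

(** Uniformity in the exponent matters: one ball must later serve a whole family of exponents. *)
Lemma powR_taylor (R : realType) (P : R) : exists2 C, 0 < C &
  forall p t : R, `|p| <= P -> `|t| <= 2^-1 ->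
  `|(1 + t) `^ p - 1 - p * t - p * (p - 1) / 2 * t ^+ 2| <= C * `|t| ^+ 3.
Proof.
(* A bound for the third derivative [g3] of the remainder, which is then integrated three times from
   0. *)
pose C := (`|P| + 1) * (`|P| + 2) * (`|P| + 3) * expR (`|P| + 3).
have C0 : 0 < C by rewrite !mulr_gt0 ?expR_gt0 ?ltr_wpDl.
exists C => // p t pP; move: t.
have pP' : `|p| <= `|P| by apply: le_trans pP (ler_norm _).
have dpow (q t : R) : `|t| <= 2^-1 ->
    is_derive t 1 (fun t : R => (1 + t) `^ q) (q * (1 + t) `^ (q - 1)).
  rewrite ler_norml => /andP[t1 t2].
  have t0 : 0 < 1 + t by lra.
  have := @is_derive1_comp R (fun x => x `^ q) (fun t => 1 + t) t
    (q * (1 + t) `^ (q - 1)) 1 (is_derive1_powR q t0).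
  rewrite mulr1; apply.
  rewrite -[X in is_derive _ _ _ X]add0r.
  exact: is_deriveD.
pose g1 t := p * (1 + t) `^ (p - 1) - p - p * (p - 1) * t.
pose g2 t := p * (p - 1) * (1 + t) `^ (p - 2) - p * (p - 1).
pose g3 t := p * (p - 1) * (p - 2) * (1 + t) `^ (p - 3).
have b3 t : `|t| <= 2^-1 -> `|g3 t| <= C * `|t| ^+ 0.
  move=> th; rewrite /g3 expr0 mulr1 !normrM /C.
  have pa a : 0 <= a -> `|p - a| <= `|P| + a.
    by move=> a0; apply: le_trans (ler_normB _ _) _; rewrite (ger0_norm a0) lerD2r.
  rewrite !ler_pM ?mulr_ge0 ?normr_ge0//.
  - by rewrite (le_trans pP')// lerDl.
  - by have := pa 1 ler01; lra.
  - by have := pa 2 (ler0n _ 2); lra.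
  - by rewrite ger0_norm ?powR_ge0//; apply: powR_bound => //; exact: pa.
have b2 t : `|t| <= 2^-1 -> `|g2 t| <= C * `|t| ^+ 1.
  apply: (@primitive_bound R g2 g3 C 2^-1 0 (ltW C0) _ _ b3 t).
    by rewrite /g2 addr0 powR1 mulr1 subrr.
  move=> {}t th; rewrite /g2 /g3; have H := dpow (p - 2) t th; apply: is_derive_eq.
  rewrite subr0 -(_ : p - 2 - 1 = p - 3); last by ring.
  by rewrite /GRing.scale /= mulrA.
have b1 t : `|t| <= 2^-1 -> `|g1 t| <= C * `|t| ^+ 2.
  apply: (@primitive_bound R g1 g2 C 2^-1 1 (ltW C0) _ _ b2 t).
    by rewrite /g1 addr0 powR1; ring.
  move=> {}t th; rewrite /g1 /g2; have H := dpow (p - 1) t th; apply: is_derive_eq.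
  rewrite -(_ : p - 1 - 1 = p - 2); last by ring.
  by rewrite subr0 /GRing.scale /= mulr1 mulrA.
move=> t.
pose g0 (t : R) := (1 + t) `^ p - 1 - p * t - p * (p - 1) / 2 * t ^+ 2.
apply: (@primitive_bound R g0 g1 C 2^-1 2 (ltW C0) _ _ b1 t).
  by rewrite /g0 addr0 powR1; ring.
move=> {}t th; rewrite /g0 /g1; have H := dpow p t th; apply: is_derive_eq.
by rewrite subr0 /GRing.scale /= !mulr1; field.
Qed.

(** * Gradient estimate for harmonic functions *)

Section gradient_estimate.
Context (R : realType) (d : nat).
Implicit Types (u : lattice d -> R) (x y : lattice d) (k : 'I_d).
Local Notation N := (euclid_norm R).

Lemma euclid_norm_nbr_sqr x k b :
  N (nbr x (k, b)) ^+ 2 = N x ^+ 2 + (-1) ^+ b * 2 * (x 0 k)%:~R + 1.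
Proof.
rewrite !euclid_norm_sqr (bigD1 k)//= [in RHS](bigD1 k)//= nbrE eqxx.
rewrite (eq_bigr (fun j => (x 0 j)%:~R ^+ 2)) => [|j jk].
  by rewrite intrD; case: b => /=; rewrite ?mulrN1z; ring.
by rewrite nbrE /= (negbTE jk) addr0.
Qed.

Lemma laplacian_euclid_norm_sqr x :
  laplacian (fun y => N y ^+ 2) x = (d * 2)%:R.
Proof.
rewrite laplacianE (eq_bigr (fun i : 'I_d * bool => (-1) ^+ i.2 * 2 * (x 0 i.1)%:~R + 1)).
  rewrite big_split /= sumr_const card_prod card_ord card_bool.
  rewrite -(pair_bigA _ (fun k (b : bool) => (-1) ^+ b * 2 * (x 0 k)%:~R)) /=.
  rewrite big1 ?add0r// => k _; rewrite big_bool /=; ring.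
by move=> [k b] _; rewrite euclid_norm_nbr_sqr; ring.
Qed.

Lemma laplacian_coord (f : int -> R) k x :
  laplacian (fun y => f (y 0 k)) x =
  f (x 0 k + 1) + f (x 0 k - 1) - 2 * f (x 0 k).
Proof.
rewrite laplacianE.
rewrite -(pair_bigA _ (fun j b => f (nbr x (j, b) 0 k) - f (x 0 k))) /=.
rewrite (bigD1 k)//= [X in _ + X]big1 => [|j jk].
  by rewrite addr0 big_bool /= !nbrE eqxx /=; ring.
by rewrite big_bool /= !nbrE /= eq_sym (negbTE jk) addr0 subrr addr0.
Qed.

(** The reflection across the hyperplane x_k = 1/2, which exchanges 0 and its neighbour in the
    positive direction [k]. *)
Definition flip k x : lattice d := \row_j (if j == k then 1 - x 0 j else x 0 j).

Lemma flipE k x j : flip k x 0 j = if j == k then 1 - x 0 j else x 0 j.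
Proof. by rewrite mxE. Qed.

Lemma flipK k : involutive (flip k).
Proof. by move=> x; apply/rowP => j; rewrite !flipE; case: eqP => // _; ring. Qed.

Lemma flip_nbr k x j b :
  flip k (nbr x (j, b)) = nbr (flip k x) (j, b (+) (j == k)).
Proof.
apply/rowP => l; rewrite flipE !nbrE flipE /=.
have [->|lk] := eqVneq l k; last first.
  by have [lj|//] := eqVneq l j; rewrite -lj (negbTE lk) addbF.
rewrite eq_sym; have [_|_] := eqVneq j k; last by rewrite !addr0.
by case: b => /=; lia.
Qed.

Lemma laplacian_flip u k x :
  laplacian (fun y => u (flip k y)) x = laplacian u (flip k x).
Proof.
pose h (i : 'I_d * bool) := (i.1, i.2 (+) (i.1 == k)).
have hK : involutive h by move=> [j b]; rewrite /h /= addbK.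
rewrite !laplacianE [RHS](reindex_inj (inv_inj hK)) /=.
by apply: eq_bigr => -[j b] _; rewrite flip_nbr.
Qed.

(* The antisymmetric function [u - u \o flip k] is controlled on the half box
   [x_k <= 0] by the superharmonic barrier [psi], linear in the distance to the
   plane [x_k = 1/2]. *)
Lemma flip_estimate u k (r M : R) : 1 <= r -> 0 < M ->
  (forall x, (forall j, `|(x 0 j)%:~R| <= r + 2) -> `|u x| <= M) ->
  (forall x, (forall j, `|(x 0 j)%:~R| <= r + 1) -> laplacian u x = 0) ->
  u 0 - u (nbr 0 (k, false)) <= 3 * (d%:R + 1) * M / r.
Proof.
move=> r1 M0 uM uh.
have r0 : 0 < r by lra.
pose h x := u x - u (flip k x).
pose D : R := d%:R + 1.
have D1 : 1 <= D by rewrite lerDr.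
(* The quadratic part gives [psi] the Laplacian 2 d - 2 D = -2. The slope [3 * D * r] keeps [c]
   nonnegative for - r - 1 <= z <= 0, hence psi >= |x|^2 >= r^2 just outside the box. Since z^2 - z
   vanishes at 0 and 1, c 0 + c 1 = 0. *)
pose c (z : int) : R := 3 * D * r * (1 / 2 - z%:~R) - D * (z%:~R ^+ 2 - z%:~R).
pose psi x := N x ^+ 2 + c (x 0 k).
pose F x := 2 * M * psi x - r ^+ 2 * h x.
have flip0 : flip k 0 = nbr 0 (k, false).
  apply/rowP => j; rewrite flipE nbrE mxE /=.
  by case: eqP => _; rewrite ?subr0 ?add0r ?addr0.
suff : 0 <= F 0.
  have -> : F 0 = r * (3 * D * M - (u 0 - u (nbr 0 (k, false))) * r).
    by rewrite /F /h flip0 /psi euclid_norm0 mxE /c mulr0z; field.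
  by rewrite pmulr_rge0// subr_ge0 ler_pdivlMr.
rewrite leNgt; apply/negP => F0.
have lapF x : (forall j, `|(x 0 j)%:~R : R| <= r) -> laplacian F x = - 4 * M.
  move=> xr.
  have xr1 : laplacian u x = 0.
    by apply: uh => j; apply: le_trans (xr j) _; rewrite lerDl.
  have xr2 : laplacian (fun y => u (flip k y)) x = 0.
    rewrite laplacian_flip; apply: uh => j; rewrite flipE.
    case: eqP => _; last by apply: le_trans (xr j) _; rewrite lerDl.
    rewrite intrB; apply: le_trans (ler_normB _ _) _.
    by rewrite normr1 addrC lerD2r.
  have lc : laplacian (fun y => c (y 0 k)) x = - 2 * D.
    by rewrite laplacian_coord /c intrD intrB; field.
  have -> : F = (fun y => 2 * M * (N y ^+ 2)) \+ ((fun y => 2 * M * c (y 0 k)) \+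
      ((fun y => - r ^+ 2 * u y) \+ (fun y => r ^+ 2 * u (flip k y)))).
    by apply/funext => y; rewrite /F /psi /h /=; ring.
  rewrite !laplacianD !laplacianZ xr1 xr2 lc laplacian_euclid_norm_sqr natrM /D.
  ring.
(* At a minimizer over [A] the Laplacian [- 4 * M] is contradicted once no neighbour has a smaller
   value of [F]. A neighbour outside [A] with [F < 0] could only leave through a face of the box or
   across the plane. *)
pose A := [set x : lattice d |
  [/\ x 0 k <= 0, forall j, `|(x 0 j)%:~R : R| <= r & F x < 0]].
have Afin : finite_set A.
  apply: (@sub_finite_set _ _ [set x | N x <= d%:R * r] _ (@finite_ball R d _)).
  move=> x /= [_ xr _]; apply: le_trans (euclid_norm_le_sum R x) _.
  apply: (le_trans (ler_sum _ (fun j _ => xr j))).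
  by rewrite sumr_const card_ord mulr_natl.
have [|p [pk pr Fp] pmin] := finite_argmin F Afin.
  by exists 0; split => // [|j]; rewrite mxE// normr0 ltW.
suff : 0 <= laplacian F p by rewrite lapF// mulNr oppr_ge0 pmulr_rle0//; lra.
rewrite laplacianE; apply: sumr_ge0 => -[j b] _; rewrite subr_ge0.
set y := nbr p (j, b).
have yr l : `|(y 0 l)%:~R : R| <= r + 1.
  rewrite nbrE intrD; apply: le_trans (ler_normD _ _) _; rewrite lerD//.
  by case: eqP => _; rewrite ?normr0//=; case: b {y}; rewrite ?normrN ?normr1.
have [yk|yk] := leP (y 0 k) 0.
  have [Fy|] := ltP (F y) 0; last by apply: le_trans; exact: ltW.
  have [yr'|] := pselect (forall l, `|(y 0 l)%:~R : R| <= r).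
    by apply: pmin.
  move=> /existsNP[l /negP]; rewrite -ltNge => yl.
  exfalso; move: Fy; apply/negP; rewrite -leNgt.
  have h2 : h y <= 2 * M.
    apply: le_trans (ler_norm _) _; apply: le_trans (ler_normB _ _) _.
    rewrite mulr_natl mulr2n lerD// uM// => m.
      by apply: le_trans (yr m) _; lra.
    rewrite flipE; case: eqP => _; last by apply: le_trans (yr m) _; lra.
    rewrite intrB; apply: le_trans (ler_normB _ _) _.
    by rewrite normr1; have := yr m; lra.
  have Ny : r ^+ 2 <= N y ^+ 2.
    rewrite lerXn2r ?nnegrE ?euclid_norm_ge0 ?ltW//.
    exact: lt_le_trans yl (coord_le_euclid_norm _ _ _).
  have cy : 0 <= c (y 0 k).
    have yk' : (y 0 k)%:~R <= 0 :> R by rewrite -(ler_int R) in yk.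
    have := yr k; rewrite ler_norml => /andP[yk2 _].
    rewrite /c; move: ((y 0 k)%:~R : R) yk' yk2 => z z0 zr.
    have : 0 <= 3 * r * (1 / 2 - z) - (z ^+ 2 - z).
      by have : 0 <= (1 / 2 - z) * (3 * r - 1 / 2 + z); [apply: mulr_ge0; lra|nra].
    move=> q; rewrite (_ : _ - _ = D * (3 * r * (1 / 2 - z) - (z ^+ 2 - z))).
      by apply: mulr_ge0 => //; lra.
    by ring.
  have r2 : 0 <= r ^+ 2 by rewrite sqr_ge0.
  have : 2 * M * r ^+ 2 <= 2 * M * psi y by rewrite ler_pM2l /psi; lra.
  have : r ^+ 2 * h y <= r ^+ 2 * (2 * M) by rewrite ler_wpM2l.
  by rewrite /F; lra.
(* A step across the plane leads to the mirror image of [p]. As [h] and [c] change sign there, F y +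
   F p = 2 M (|y|^2 + |p|^2) >= 0, whence F y > 0. *)
have [jk bF pk0] : [/\ j = k, b = false & p 0 k = 0].
  move: yk; rewrite nbrE /=; case: eqP => [kj|_]; last lia.
  by case: b {y yr} => /=; [lia|split => //; lia].
have yE : y = flip k p.
  apply/rowP => l; rewrite flipE nbrE /= jk bF.
  case: eqP => [->|_] /=; last by rewrite addr0.
  by rewrite pk0.
have cc : c 0 + c 1 = 0 by rewrite /c; field.
have yk1 : y 0 k = 1 by rewrite yE flipE eqxx pk0.
move: Fp; rewrite /F /psi pk0 yk1 [h y]/h yE flipK.
have -> : u (flip k p) - u p = - h p by rewrite /h opprB.
have := sqr_ge0 (N p); have := sqr_ge0 (N (flip k p)).
have -> : c 1 = - c 0 by lra.
nra.
Qed.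

(** The one-sided reflection bound, applied to translates of [u] and of [- u]. *)
Lemma gradient_estimate u z k (r M : R) : 1 <= r -> 0 < M ->
  (forall x, (forall j, `|((x - z) 0 j)%:~R| <= r + 2) -> `|u x| <= M) ->
  (forall x, (forall j, `|((x - z) 0 j)%:~R| <= r + 1) -> laplacian u x = 0) ->
  `|u (nbr z (k, false)) - u z| <= 3 * (d%:R + 1) * M / r.
Proof.
move=> r1 M0 uM uh.
have key (a : R) : `|a| = 1 ->
    a * u z - a * u (nbr z (k, false)) <= 3 * (d%:R + 1) * M / r.
  move=> a1; pose v x := a * u (x - - z).
  have lv x : laplacian v x = a * laplacian u (x - - z).
    by rewrite laplacianZ laplacian_shift.
  have <- : v 0 = a * u z by rewrite /v opprK add0r.
  have <- : v (nbr 0 (k, false)) = a * u (nbr z (k, false)).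
    by rewrite /v opprK /nbr add0r addrC.
  apply: flip_estimate => // x hx.
    by rewrite /v normrM a1 mul1r; apply: uM => j; rewrite opprK addrK.
  by rewrite lv uh ?mulr0// => j; rewrite opprK addrK.
have h1 := key 1 (normr1 _); have h2 := key (-1) (normrN1 _).
rewrite ler_norml; apply/andP; split; move: h1 h2; lra.
Qed.

End gradient_estimate.

(** * The fundamental solution at infinity *)

(** Relative increments make the constant independent of [u] and [x]; the expansion serves both
    |x|^2 and [Phi]. *)
Lemma laplacian_powR_taylor (R : realType) (d : nat) (P : R) :
  exists2 C, 0 < C & forall (p : R) (u : lattice d -> R) x, `|p| <= P ->
    0 < u x ->
    let t i := u (nbr x i) / u x - 1 in
    (forall i, `|t i| <= 2^-1) ->
    `|laplacian (fun y => u y `^ p) x -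
      u x `^ p * (p * \sum_i t i + p * (p - 1) / 2 * \sum_i t i ^+ 2)| <=
    C * u x `^ p * \sum_i `|t i| ^+ 3.
Proof.
have [C C0 hC] := powR_taylor P; exists C => // p u x pP ux t th.
rewrite laplacianE !mulr_sumr -big_split /= mulr_sumr -sumrB.
apply: le_trans (ler_norm_sum _ _ _) _.
apply: ler_sum => i _.
have t1 : 0 <= 1 + t i by have := th i; rewrite ler_norml => /andP[]; lra.
have -> : u (nbr x i) = u x * (1 + t i).
  by rewrite /t addrC subrK mulrC divfK// gt_eqF.
rewrite powRM//; last exact: ltW.
rewrite [X in `|X|](_ : _ = u x `^ p *
    ((1 + t i) `^ p - 1 - p * t i - p * (p - 1) / 2 * t i ^+ 2)); last by ring.
rewrite [leRHS](_ : _ = u x `^ p * (C * `|t i| ^+ 3)); last by ring.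
by rewrite normrM ger0_norm ?powR_ge0// ler_wpM2l ?powR_ge0//; exact: hC.
Qed.

Lemma near_infinity_powR_le (R : realType) (d : nat) (a e : R) : a < 0 -> 0 < e ->
  \forall x \near at_infinity R d, euclid_norm R x `^ a <= e.
Proof.
move=> a0 e0; pose M := e^-1 `^ (- a)^-1.
have na : 0 < - a by rewrite oppr_gt0.
have Ma : M `^ (- a) = e^-1.
  by rewrite /M -powRrM mulVf ?gt_eqF// powRr1// invr_ge0 ltW.
near=> x.
rewrite -[a]opprK powRN -[leRHS]invrK lef_pV2 ?posrE ?invr_gt0//.
  rewrite -Ma ge0_ler_powR ?nnegrE ?powR_ge0 ?euclid_norm_ge0//; first exact: ltW.
  by apply: ltW; near: x; exact: near_infinity_gt.
by apply: powR_gt0; near: x; exact: near_infinity_gt.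
Unshelve. all: by end_near. Qed.

Section norm_barrier.
Context (R : realType) (d : nat).
Local Notation N := (euclid_norm R).

(** The leading coefficient is that of the Laplacian of |x|^(2p) in the continuum. The sums of [t]
    and of [t ^+ 2] are exact, the odd terms cancelling between opposite neighbours. *)
Lemma laplacian_norm_powR (p : R) : exists2 C, 0 < C &
  \forall x \near at_infinity R d,
  `|laplacian (fun y => (N y ^+ 2) `^ p) x -
    2 * p * (d%:R + 2 * p - 2) * (N x ^+ 2) `^ p / N x ^+ 2| <=
  C * (N x ^+ 2) `^ p / N x ^+ 2 / N x.
Proof.
have [C C0 hC] := @laplacian_powR_taylor R d `|p|.
(* [54 * d] is 2 d neighbours times 3^3 from the cubic remainder; the other term is the n^-4 part of
   the sum of squares. *)
pose C' := C * (54 * d%:R) + `|p * (p - 1) * d%:R|.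
exists (C' + 1); first by rewrite ltr_wpDl// addr_ge0// !mulr_ge0// ltW.
near=> x.
have x6 : 6 < N x by near: x; exact: near_infinity_gt.
have x0 : 0 < N x by lra.
pose n := N x; rewrite -/n in x6 x0 *.
have := hC p (fun y => N y ^+ 2) x (lexx _) (exprn_gt0 2 x0).
rewrite /=; set t := fun i => N (nbr x i) ^+ 2 / n ^+ 2 - 1.
have tE k b : t (k, b) = ((-1) ^+ b * 2 * (x 0 k)%:~R + 1) / n ^+ 2.
  by rewrite /t euclid_norm_nbr_sqr -/n; field; rewrite gt_eqF.
have t3 i : `|t i| <= 3 / n.
  case: i => k b; rewrite tE normrM normfV (ger0_norm (sqr_ge0 _)).
  rewrite ler_pdivrMr ?exprn_gt0// (_ : 3 / n * n ^+ 2 = 3 * n); last first.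
    by field; rewrite gt_eqF.
  apply: le_trans (ler_normD _ _) _; rewrite !normrM normrX normrN1 expr1n.
  rewrite normr1 mul1r ger0_norm//; have := coord_le_euclid_norm R x k.
  by rewrite -/n; lra.
have sum1 : \sum_i t i = 2 * d%:R / n ^+ 2.
  rewrite -(pair_bigA _ (fun k b => t (k, b))) /=.
  rewrite (eq_bigr (fun=> 2 / n ^+ 2)) => [|k _].
    by rewrite sumr_const card_ord -mulr_natr; ring.
  by rewrite big_bool /= !tE /=; field; rewrite gt_eqF.
have sum2 : \sum_i t i ^+ 2 = 8 / n ^+ 2 + 2 * d%:R / n ^+ 4.
  rewrite -(pair_bigA _ (fun k b => t (k, b) ^+ 2)) /=.
  rewrite (eq_bigr (fun k => 8 / n ^+ 4 * (x 0 k)%:~R ^+ 2 + 2 / n ^+ 4)) => [|k _].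
    rewrite big_split /= -mulr_sumr sumr_const card_ord -mulr_natr.
    by rewrite -euclid_norm_sqr -/n; field; rewrite gt_eqF.
  by rewrite big_bool /= !tE /=; field; rewrite gt_eqF.
have sum3 : \sum_i `|t i| ^+ 3 <= 54 * d%:R / n ^+ 3.
  apply: (@le_trans _ _ (\sum_(i : 'I_d * bool) (3 / n) ^+ 3)).
    by apply: ler_sum => i _; rewrite lerXn2r ?nnegrE// divr_ge0// ltW.
  rewrite sumr_const card_prod card_ord card_bool -[leLHS]mulr_natr natrM le_eqVlt.
  by apply/orP; left; apply/eqP; field; rewrite gt_eqF.
move=> h.
have {}h := h (fun i => le_trans (t3 i) _).
have {}h := h ltac:(by rewrite ler_pdivrMr//; lra).
rewrite sum1 sum2 in h.
set A := (n ^+ 2) `^ p in h *; have A0 : 0 < A by apply/powR_gt0/exprn_gt0.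
have -> : laplacian (fun y => (N y ^+ 2) `^ p) x -
    2 * p * (d%:R + 2 * p - 2) * A / n ^+ 2 =
    (laplacian (fun y => (N y ^+ 2) `^ p) x -
    A * (p * (2 * d%:R / n ^+ 2) + p * (p - 1) / 2 * (8 / n ^+ 2 + 2 * d%:R / n ^+ 4)))
    + A * (p * (p - 1) * d%:R) / n ^+ 4 by field; rewrite gt_eqF.
apply: le_trans (ler_normD _ _) _.
have h1 := le_trans h (ler_wpM2l (mulr_ge0 (ltW C0) (ltW A0)) sum3).
have h2 : `|A * (p * (p - 1) * d%:R) / n ^+ 4| <= A * `|p * (p - 1) * d%:R| / n ^+ 3.
  rewrite normrM [`|A * _|]normrM (gtr0_norm A0) normfV [`|n ^+ 4|]gtr0_norm ?exprn_gt0//.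
  rewrite ler_wpM2l ?mulr_ge0 ?(ltW A0)// lef_pV2 ?posrE ?exprn_gt0//.
  by rewrite ler_weXn2l//; lra.
apply: le_trans (lerD h1 h2) _.
have -> : (C' + 1) * A / n ^+ 2 / n = C * A * (54 * d%:R / n ^+ 3) +
    A * `|p * (p - 1) * d%:R| / n ^+ 3 + A / n ^+ 3.
  by rewrite /C'; field; rewrite gt_eqF.
by rewrite lerDl divr_ge0 ?exprn_ge0 ?ltW.
Unshelve. all: by end_near. Qed.

Lemma sqr_powR (x a : R) : 0 <= x -> (x ^+ 2) `^ a = x `^ (2 * a).
Proof. by move=> x0; rewrite powRrM powR_mulrn. Qed.

(* [|x|^(2-d)] is harmonic only to leading order; the Laplacian of the lower
   order power [|x|^(3/2-d)] has a sign and absorbs the error, so that their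
   sum and difference are barriers at infinity. *)
Lemma norm_barrier : (3 <= d)%N ->
  let p := (2 - d%:R) / 2 : R in
  \forall x \near at_infinity R d,
  `|laplacian (fun y => (N y ^+ 2) `^ p) x| <=
  laplacian (fun y => (N y ^+ 2) `^ (p - 4^-1)) x.
Proof.
move=> d3 p; have d3R : 3 <= d%:R :> R by rewrite ler_nat.
have [C0 C00 h0] := laplacian_norm_powR p.
have [C1 C10 h1] := laplacian_norm_powR (p - 4^-1).
near=> x.
have x0 : 0 < N x by near: x; exact: near_infinity_gt.
have : `|laplacian (fun y => (N y ^+ 2) `^ p) x -
    2 * p * (d%:R + 2 * p - 2) * (N x ^+ 2) `^ p / N x ^+ 2| <=
  C0 * (N x ^+ 2) `^ p / N x ^+ 2 / N x by near: x.
have : `|laplacian (fun y => (N y ^+ 2) `^ (p - 4^-1)) x -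
    2 * (p - 4^-1) * (d%:R + 2 * (p - 4^-1) - 2) * (N x ^+ 2) `^ (p - 4^-1) / N x ^+ 2| <=
  C1 * (N x ^+ 2) `^ (p - 4^-1) / N x ^+ 2 / N x by near: x.
have s0 : N x `^ (- 2^-1) <= (4 * C0)^-1.
  by near: x; apply: near_infinity_powR_le; rewrite ?oppr_lt0// invr_gt0 mulr_gt0.
have s1 : 4 * C1 < N x by near: x; exact: near_infinity_gt.
(* As d - 2 = - 2 p, the leading coefficient vanishes at [p] and is at least 3/4 at [p - 4^-1]; each
   of the two errors costs at most 1/4. *)
have -> : 2 * (p - 4^-1) * (d%:R + 2 * (p - 4^-1) - 2) = 4^-1 - p.
  by rewrite /p; field.
have -> : 2 * p * (d%:R + 2 * p - 2) = 0 by rewrite /p; field.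
rewrite !mul0r subr0.
have -> : C0 * (N x ^+ 2) `^ p / N x ^+ 2 / N x =
    C0 * N x `^ (- 2^-1) * ((N x ^+ 2) `^ (p - 4^-1) / N x ^+ 2).
  have -> : (N x ^+ 2) `^ p = (N x ^+ 2) `^ (p - 4^-1) * (N x * N x `^ (- 2^-1)).
    rewrite !sqr_powR ?ltW// -{3}[N x]powRr1 ?ltW// -!powRD.
    - by congr (_ `^ _); field.
    - by apply/implyP => _; rewrite gt_eqF.
    - by apply/implyP => _; rewrite gt_eqF.
  by field; rewrite gt_eqF.
have -> : C1 * (N x ^+ 2) `^ (p - 4^-1) / N x ^+ 2 / N x =
    C1 / N x * ((N x ^+ 2) `^ (p - 4^-1) / N x ^+ 2).
  by field; rewrite gt_eqF.
rewrite -mulrA; set A := _ `^ (p - _) / _.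
have A0 : 0 < A by rewrite divr_gt0 ?exprn_gt0//; apply/powR_gt0/exprn_gt0.
have c0 : C0 * N x `^ (- 2^-1) <= 4^-1.
  by rewrite -ler_pdivlMl// -invfM mulrC.
have c1 : C1 / N x <= 4^-1 by rewrite ler_pdivrMr//; lra.
have p4 : 3 / 4 <= 4^-1 - p by rewrite /p; lra.
rewrite ler_norml => /andP[l1 _] l2.
apply: le_trans l2 _.
move: l1; set l := laplacian _ x; move: (C0 * _) (C1 / _) (4^-1 - p) c0 c1 p4 => a b q *.
nra.
Unshelve. all: by end_near. Qed.

End norm_barrier.

Lemma schrodinger0 (R : realType) (d : nat) (u : lattice d -> R) x :
  schrodinger (fun=> 0) u x = - laplacian u x.
Proof. by rewrite /schrodinger mul0r addr0. Qed.

Section fundamental_solution.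
Context (R : realType) (d : nat) (Phi : lattice d -> R).
Hypotheses (d3 : (3 <= d)%N) (Phi_fund : fundamental_solution Phi).
Local Notation N := (euclid_norm R).

Let d0 : (0 < d)%N. Proof. exact: leq_trans d3. Qed.

Let one_gt0 (x : lattice d) : 0 < (1 : R). Proof. exact: ltr01. Qed.

(** For [V = 0] the constant 1 is the reference supersolution, so negligible means tending to 0. *)
Let one_super (x : lattice d) : 0 <= schrodinger (fun=> 0) (fun=> 1 : R) x.
Proof.
by rewrite schrodinger0 laplacianE big1 ?oppr0// => i _; rewrite subrr.
Qed.

Let Phi_lim (e : R) : 0 < e -> \forall x \near at_infinity R d, `|Phi x| <= e.
Proof.
move=> e0; have [_ /cvgrPdist_le/(_ e e0)] := Phi_fund.
by apply: filterS => x; rewrite sub0r normrN.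
Qed.

Lemma fundamental_solution_harmonic x : x != 0 -> laplacian Phi x = 0.
Proof.
by move=> x0; apply/eqP; rewrite -oppr_eq0 (proj1 Phi_fund) /delta (negbTE x0).
Qed.

(** Comparison gives [0 <= Phi] because [Phi] tends to 0; the source at 0 makes it strict. *)
Lemma fundamental_solution_gt0 x : 0 < Phi x.
Proof.
have L0 y : delta R 0 y <= schrodinger (fun=> 0) Phi y.
  by rewrite schrodinger0 (proj1 Phi_fund).
apply: (@supersolution_gt0 R d (fun=> 0) _ 0) => [y|].
  by rewrite addr0 ltr0n muln_gt0 d0.
split=> //.
apply: (comparison d0 one_gt0 one_super) => [y _|e e0].
  by apply: le_trans (L0 y); rewrite ler0n.
have := Phi_lim e0; apply: filterS => y.
by rewrite mulr1 ler_norml => /andP[].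
Qed.

Lemma fundamental_solution_bounds : exists c C r, [/\ 0 < c, 0 < C &
  forall x, r < N x -> c * N x `^ (2 - d%:R) <= Phi x <= C * N x `^ (2 - d%:R)].
Proof.
pose p := (2 - d%:R) / 2 : R.
pose f q (y : lattice d) : R := (N y ^+ 2) `^ q.
have fE x : f p x = N x `^ (2 - d%:R).
  by rewrite /f sqr_powR ?euclid_norm_ge0//; congr (_ `^ _); rewrite /p; field.
have f1E x : 0 < N x -> f (p - 4^-1) x = f p x * N x `^ (- 2^-1).
  move=> x0; rewrite /f !sqr_powR ?euclid_norm_ge0// -powRD; last first.
    by apply/implyP => _; rewrite gt_eqF.
  by congr (_ `^ _); field.
have /near_infinityP[r1 hr1] := @norm_barrier R d d3.
pose r := Num.max r1 1.
have hr (x : lattice d) : r < N x -> r1 < N x /\ 1 < N x.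
  by rewrite gt_max => /andP[].
have f0 q x : r < N x -> 0 < f q x.
  by move=> /hr[_ x1]; apply/powR_gt0/exprn_gt0/(lt_trans ltr01).
have f1f x : r < N x -> f (p - 4^-1) x < f p x.
  move=> rx; have [_ x1] := hr _ rx; have x0 := lt_trans ltr01 x1.
  rewrite f1E// -[ltRHS]mulr1 ltr_pM2l ?f0// powRN invf_lt1 ?powR_gt0//.
  have := @gt0_ltr_powR R 2^-1 _ 1 (N x); rewrite powR1.
  by apply => //; rewrite ?invr_gt0// nnegrE ltW.
have lapf : forall x, r < N x ->
    `|laplacian (f p) x| <= laplacian (f (p - 4^-1)) x.
  by move=> x /hr[rx _]; exact: hr1.
have lapW (a : R) x : laplacian (fun y => f p y + a * f (p - 4^-1) y) x =
    laplacian (f p) x + a * laplacian (f (p - 4^-1)) x.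
  by rewrite -laplacianZ -laplacianD.
have lap0 x : r < N x -> laplacian Phi x = 0.
  move=> /hr[_ x1]; apply: fundamental_solution_harmonic.
  by apply/eqP => xE; move: x1; rewrite xE euclid_norm0; lra.
(* The difference is superharmonic, positive because |x| > 1, and at most [f p]. *)
have [K1 K10 h1] : exists2 K, 0 < K & forall x, r < N x ->
    Phi x <= K * (f p x + -1 * f (p - 4^-1) x).
  apply: (exterior_domination d0 one_gt0 one_super) => [x rx|x rx|x rx|e e0].
  - by have := f1f _ rx; lra.
  - rewrite schrodinger0 lapW; have := lapf _ rx.
    by rewrite ler_norml => /andP[]; lra.
  - by rewrite schrodinger0 lap0// oppr0.
  - have := Phi_lim e0; apply: filterS => y.
    by rewrite mulr1 ler_norml => /andP[].
(* The sum is subharmonic and at least [f p]; here [Phi] is the dominating function. *)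
have [K2 K20 h2] : exists2 K, 0 < K & forall x, r < N x ->
    f p x + 1 * f (p - 4^-1) x <= K * Phi x.
  apply: (exterior_domination d0 one_gt0 one_super) => [x rx|x rx|x rx|e e0].
  - exact: fundamental_solution_gt0.
  - by rewrite schrodinger0 lap0// oppr0.
  - rewrite schrodinger0 lapW; have := lapf _ rx.
    by rewrite ler_norml => /andP[]; lra.
  - near=> x.
    have rx : r < N x by near: x; exact: near_infinity_gt.
    have : f p x <= e / 2.
      rewrite fE; near: x; apply: near_infinity_powR_le; last by rewrite divr_gt0.
      have : 3 <= d%:R :> R by rewrite ler_nat.
      lra.
    by have := f1f _ rx; lra.
exists K2^-1, K1, r; split => [||x rx]; rewrite ?invr_gt0// -fE.
have := h1 x rx; have := h2 x rx; have := f0 p _ rx; have := f0 (p - 4^-1) _ rx.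
move=> f1 f2 h3 h4; apply/andP; split.
  by rewrite ler_pdivrMl//; lra.
by apply: le_trans h4 _; rewrite ler_pM2l//; lra.
Unshelve. all: by end_near. Qed.

End fundamental_solution.

Lemma le0_ler_powR (R : realType) (e a b : R) : e <= 0 -> 0 < a -> a <= b ->
  b `^ e <= a `^ e.
Proof.
move=> e0 a0 ab; have b0 := lt_le_trans a0 ab.
rewrite -(opprK e) !(powRN _ (- e)) lef_pV2 ?posrE ?powR_gt0//.
by apply: ge0_ler_powR; rewrite ?nnegrE ?oppr_ge0// ltW.
Qed.

(** * Gradient of the fundamental solution and Laplacian of its powers *)

Section fundamental_solution_gradient.
Context (R : realType) (d : nat) (Phi : lattice d -> R).
Hypotheses (d3 : (3 <= d)%N) (Phi_fund : fundamental_solution Phi).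
Local Notation N := (euclid_norm R).

Let Phi0 := fundamental_solution_gt0 d3 Phi_fund.

(** On a box of size proportional to |x| around [x], [Phi] is harmonic and bounded by a multiple of
    [Phi x]. *)
Lemma fundamental_solution_gradient : exists2 C, 0 < C &
  \forall x \near at_infinity R d, forall i,
    `|Phi (nbr x i) / Phi x - 1| <= C / N x.
Proof.
have [c [C [r [c0 C0 hPhi]]]] := fundamental_solution_bounds d3 Phi_fund.
have d3R : 3 <= d%:R :> R by rewrite ler_nat.
(* For |y| >= |x| / 2 the two-sided bounds give Phi y <= B Phi x. *)
pose B := C / c * 2 `^ (d%:R - 2).
have B0 : 0 < B by rewrite !mulr_gt0 ?invr_gt0 ?powR_gt0.
exists (12 * d%:R * (d%:R + 1) * B).
  by apply: mulr_gt0 => //; apply: mulr_gt0; lra.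
near=> x.
have xr : 2 * r < N x by near: x; exact: near_infinity_gt.
have xd : 8 * d%:R + 4 < N x by near: x; exact: near_infinity_gt.
have x0 : 0 < N x by lra.
pose M := B * Phi x; have M0 : 0 < M by rewrite mulr_gt0.
(* A point of the box of half-width q + 2 around [z] is within d q + 2 d + 1 < |x| / 2 of [x]. The
   centre [z] is [x] or a neighbour of [x], to cover backward differences. *)
pose q := N x / (4 * d%:R).
have dq : d%:R * q = N x / 4 by rewrite /q; field; rewrite gt_eqF//; lra.
have q1 : 1 <= q by rewrite /q ler_pdivlMr; lra.
have key z k : N (z - x) <= 1 ->
    `|Phi (nbr z (k, false)) - Phi z| <= 3 * (d%:R + 1) * M / q.
  move=> zx.
  have far (a : R) y : a <= q + 2 -> (forall j, `|((y - z) 0 j)%:~R : R| <= a) ->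
      N x / 2 <= N y.
    move=> aq yz.
    have : N (y - z) <= d%:R * q + 2 * d%:R.
      apply: le_trans (euclid_norm_le_sum R _) _.
      apply: (@le_trans _ _ (\sum_(j < d) (q + 2))).
        by apply: ler_sum => j _; exact: le_trans (yz j) aq.
      by rewrite sumr_const card_ord -[leLHS]mulr_natl; lra.
    have := euclid_norm_triangleB R x y; have := euclid_norm_triangle R (y - z) (z - x).
    rewrite addrA subrK euclid_normB dq => h1 h2 h3; lra.
  apply: gradient_estimate => // y hy.
  - have yx := far _ y (lexx _) hy.
    rewrite gtr0_norm//.
    have /hPhi/andP[_ hy2] : r < N y by lra.
    apply: le_trans hy2 _.
    have /hPhi/andP[hx _] : r < N x by lra.
    have : N y `^ (2 - d%:R) <= 2 `^ (d%:R - 2) * N x `^ (2 - d%:R).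
      apply: (@le_trans _ _ ((N x / 2) `^ (2 - d%:R))).
        by apply: le0_ler_powR => //; lra.
      rewrite powRM ?invr_ge0//; last exact: ltW.
      by rewrite -powR_inv1// -powRrM mulN1r opprB mulrC.
    move=> /(ler_wpM2l (ltW C0)) hy3; apply: le_trans hy3 _.
    rewrite /M /B mulrA (_ : C / c * _ * _ = C * 2 `^ (d%:R - 2) * (Phi x / c)).
      rewrite ler_pM2l ?mulr_gt0 ?powR_gt0// ler_pdivlMr//.
      by rewrite mulrC.
    by field; rewrite gt_eqF.
  - apply: fundamental_solution_harmonic => //.
    have : N x / 2 <= N y by apply: far hy; lra.
    by apply: contraTneq => ->; rewrite euclid_norm0; lra.
have fin w : `|w| <= 3 * (d%:R + 1) * M / q ->
    `|w / Phi x| <= 12 * d%:R * (d%:R + 1) * B / N x.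
  move=> hw; rewrite normrM normfV (gtr0_norm (Phi0 x)) ler_pdivrMr//.
  apply: le_trans hw _; rewrite le_eqVlt; apply/orP; left; apply/eqP.
  by rewrite /M /q; field; rewrite !gt_eqF//; lra.
move=> [k b].
have -> : Phi (nbr x (k, b)) / Phi x - 1 = (Phi (nbr x (k, b)) - Phi x) / Phi x.
  by rewrite mulrBl divff// gt_eqF.
apply: fin; case: b; last by apply: key; rewrite subrr euclid_norm0.
rewrite distrC -{1}(nbr_opp x k true); apply: key.
by rewrite euclid_norm_nbr.
Unshelve. all: by end_near. Qed.

(* With [t i = Phi (nbr x i) / Phi x - 1], whose sum vanishes, a Taylor expansion
   gives [- laplacian (Phi ^ p) / Phi ^ p = p (1 - p) / 2 * sum t^2 + O(sum |t|^3)],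
   and [p = 1/2] expresses [sum t^2] through the Hardy potential. *)
Lemma powR_hardy_potential (P : R) : exists2 C, 0 < C &
  \forall x \near at_infinity R d, forall p, `|p| <= P ->
  `|- laplacian (fun y => Phi y `^ p) x -
    4 * p * (1 - p) * hardy_potential Phi x * Phi x `^ p| <=
  C / N x * hardy_potential Phi x * Phi x `^ p.
Proof.
(* Large enough to admit the exponent 1/2 besides [p]. *)
pose Q := `|P| + 1; have Q1 : 1 <= Q by rewrite lerDr.
have [C C0 hC] := @laplacian_powR_taylor R d Q.
have [C1 C10 hC1] := fundamental_solution_gradient.
exists (16 * C * (1 + 4 * Q * (1 + Q)) * C1); first by rewrite !mulr_gt0//; nra.
near=> x.
have xC1 : forall i, `|Phi (nbr x i) / Phi x - 1| <= C1 / N x by near: x.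
have x1 : 1 < N x by near: x; exact: near_infinity_gt.
have x2 : 2 * C1 < N x by near: x; exact: near_infinity_gt.
have x3 : 16 * C * C1 < N x by near: x; exact: near_infinity_gt.
move=> p pP; pose t i := Phi (nbr x i) / Phi x - 1; pose S := \sum_i t i ^+ 2.
pose tau := C1 / N x.
have ttau i : `|t i| <= tau by exact: xC1.
have tau2 : tau <= 2^-1 by rewrite ler_pdivrMr; lra.
have Ctau : C * tau <= 16^-1 by rewrite mulrA ler_pdivrMr; lra.
have tau0 : 0 < tau by rewrite divr_gt0//; lra.
have S0 : 0 <= S by apply: sumr_ge0 => i _; exact: sqr_ge0.
have t0 : \sum_i t i = 0.
  transitivity (laplacian Phi x / Phi x); last first.
    rewrite fundamental_solution_harmonic ?mul0r//.
    by apply: contraTneq x1 => ->; rewrite euclid_norm0; lra.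
  rewrite laplacianE mulr_suml; apply: eq_bigr => i _.
  by rewrite mulrBl divff// gt_eqF.
have t3 : \sum_i `|t i| ^+ 3 <= tau * S.
  rewrite mulr_sumr; apply: ler_sum => i _; rewrite exprS -[t i ^+ 2]ger0_norm ?sqr_ge0//.
  by rewrite normrX ler_wpM2r ?sqr_ge0.
have main (a : R) : `|a| <= Q ->
    `|- laplacian (fun y => Phi y `^ a) x - 4 * a * (1 - a) * (S / 8) * Phi x `^ a| <=
    C * tau * S * Phi x `^ a.
  move=> aQ; have := hC a Phi x aQ (Phi0 x) (fun i => le_trans (ttau i) tau2).
  rewrite -/S t0 -normrN => h.
  rewrite [X in `|X|](_ : _ = - (laplacian (fun y => Phi y `^ a) x -
     Phi x `^ a * (a * 0 + a * (a - 1) / 2 * S))); last by field.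
  apply: le_trans h _.
  rewrite [leRHS](_ : _ = C * Phi x `^ a * (tau * S)); last by ring.
  by rewrite ler_wpM2l// mulr_ge0 ?powR_ge0// ltW.
set H := hardy_potential Phi x.
have HS : `|H - S / 8| <= C * tau * S.
  have hQ : `|2^-1 : R| <= Q by rewrite ger0_norm ?invr_ge0//; lra.
  have := main 2^-1 hQ.
  have f0 : 0 < Phi x `^ 2^-1 by exact: powR_gt0.
  have -> : - laplacian (fun y => Phi y `^ 2^-1) x = H * Phi x `^ 2^-1.
    rewrite /H /hardy_potential powR12_sqrt ?ltW// mulfVK; last first.
      by rewrite gt_eqF// sqrtr_gt0.
    by congr (- laplacian _ x); apply/funext => y; rewrite powR12_sqrt// ltW.
  rewrite (_ : _ - _ = (H - S / 8) * Phi x `^ 2^-1); last by field.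
  by rewrite normrM (gtr0_norm f0) ler_pM2r.
(* Absorbing the error, at most S / 16, into S / 8 turns errors relative to [S] into errors relative
   to [H]. *)
have SH : S <= 16 * H.
  move: HS; rewrite ler_norml => /andP[h _].
  by have : C * tau * S <= 16^-1 * S; [rewrite ler_wpM2r|lra].
have H0 : 0 <= H by lra.
have pQ : `|p| <= Q by apply: le_trans pP (le_trans (ler_norm _) _); rewrite lerDl.
have pQ' : `|p * (1 - p)| <= Q * (1 + Q).
  rewrite normrM ler_pM//; apply: le_trans (ler_normB _ _) _.
  by rewrite normr1 lerD2l.
set A := Phi x `^ p; have A0 : 0 < A by exact: powR_gt0.
set l := - laplacian _ x.
rewrite (_ : l - _ = (l - 4 * p * (1 - p) * (S / 8) * A) -
   4 * (p * (1 - p)) * (H - S / 8) * A); last by ring.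
apply: le_trans (ler_normB _ _) _.
have CS : C * tau * S <= C * tau * (16 * H).
  by rewrite ler_wpM2l// mulr_ge0// ltW.
have h1 : `|l - 4 * p * (1 - p) * (S / 8) * A| <= C * tau * (16 * H) * A.
  by apply: le_trans (main p pQ) _; rewrite ler_pM2r.
have h2 : `|4 * (p * (1 - p)) * (H - S / 8) * A| <=
    4 * (Q * (1 + Q)) * (C * tau * (16 * H)) * A.
  rewrite normrM (gtr0_norm A0) ler_pM2r// normrM ler_pM//.
    by rewrite normrM ger0_norm// ler_pM2l.
  exact: le_trans HS CS.
apply: le_trans (lerD h1 h2) _; rewrite le_eqVlt; apply/orP; left; apply/eqP.
by rewrite /tau; field; rewrite gt_eqF//; lra.
Unshelve. all: by end_near. Qed.

(** Concavity of the square root, in the form (sqrt w - s)^2 >= 0. At the origin the bound is 1 / (2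
    Phi 0), which yields strict positivity there. *)
Lemma hardy_potential_ge x :
  - laplacian Phi x / (2 * Phi x) <= hardy_potential Phi x.
Proof.
have P0 := Phi0 x; pose s := Num.sqrt (Phi x).
have s0 : 0 < s by rewrite sqrtr_gt0.
have s2 : Phi x = s ^+ 2 by rewrite sqr_sqrtr// ltW.
rewrite /hardy_potential -/s ler_pdivlMr// s2.
rewrite (_ : _ / _ * s = - laplacian Phi x / (2 * s)); last by field; rewrite gt_eqF.
rewrite ler_pdivrMr ?mulr_gt0// mulNr lerN2 mulrC !laplacianE mulr_sumr.
apply: ler_sum => i _; rewrite s2 -/s.
set w := Phi (nbr x i).
have -> : w = Num.sqrt w ^+ 2 by rewrite sqr_sqrtr// ltW// /w.
rewrite !sqrtr_sqr !ger0_norm ?sqrtr_ge0 ?(ltW s0)//.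
by have := sqr_ge0 (Num.sqrt w - s); nra.
Qed.

End fundamental_solution_gradient.

Lemma near_infinity_bound (R : realType) (d : nat) (f g : lattice d -> R) C :
  (forall x, 0 < g x) -> (\forall x \near at_infinity R d, f x <= C * g x) ->
  exists2 K, 0 < K & forall x, f x <= K * g x.
Proof.
move=> g0 /near_infinityP[M hM].
have [K K0 hK] := finite_bound (fun x => f x / g x) (@finite_ball R d M).
exists (Num.max K C) => [|x]; first by rewrite lt_max K0.
have [xM|Mx] := leP (euclid_norm R x) M.
  by rewrite -ler_pdivrMr// le_max hK.
by apply: le_trans (hM x Mx) _; rewrite ler_pM2r// le_max lexx orbT.
Qed.

Lemma near_infinity_centered (R : realType) (d : nat) (P : set (lattice d)) xi :
  (\forall x \near at_infinity R d, P x) ->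
  exists M : R, forall x, M < euclid_norm R (x - xi) -> P x.
Proof.
move=> /near_infinityP[M hM]; exists (M + euclid_norm R xi) => x Mx; apply: hM.
have := euclid_norm_triangle R x (- xi); rewrite euclid_normN; lra.
Qed.

(** * Powers of the fundamental solution at infinity *)

Section fundamental_solution_powers.
Context (R : realType) (d : nat) (Phi : lattice d -> R).
Hypotheses (d3 : (3 <= d)%N) (Phi_fund : fundamental_solution Phi).
Local Notation N := (euclid_norm R).

Let Phi0 := fundamental_solution_gt0 d3 Phi_fund.

Lemma near_infinity_fundamental_powR_le (a e : R) : 0 < a -> 0 < e ->
  \forall x \near at_infinity R d, Phi x `^ a <= e.
Proof.
move=> a0 e0; have [_ /cvgrPdist_le/(_ (e `^ a^-1))] := Phi_fund.
rewrite powR_gt0// => /(_ isT); apply: filterS => x.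
rewrite sub0r normrN gtr0_norm// => /(ge0_ler_powR (ltW a0)).
rewrite !nnegrE ltW// powR_ge0 => /(_ isT isT) /le_trans; apply.
by rewrite -powRrM mulVf ?gt_eqF// powRr1// ltW.
Qed.

(** Once |x| > 2 |xi|, the norms |x| and |x - xi| agree up to a factor 2, which costs the factor
    [B]. *)
Lemma fundamental_powR_bounds_ge0 (xi : lattice d) (a : R) : 0 <= a ->
  exists2 K, 0 < K & \forall x \near at_infinity R d,
    K^-1 * N (x - xi) `^ ((2 - d%:R) * a) <= Phi x `^ a <=
    K * N (x - xi) `^ ((2 - d%:R) * a).
Proof.
move=> a0; have [c [C [r [c0 C0 hPhi]]]] := fundamental_solution_bounds d3 Phi_fund.
have d3R : 3 <= d%:R :> R by rewrite ler_nat.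
pose e : R := 2 - d%:R.
pose B : R := 2 `^ (- e); have B0 : 0 < B by exact: powR_gt0.
pose K1 := (c / B) `^ a; pose K2 := (C * B) `^ a.
have K10 : 0 < K1 by rewrite powR_gt0// divr_gt0.
have K20 : 0 < K2 by rewrite powR_gt0// mulr_gt0.
exists (Num.max K1^-1 K2); first by rewrite lt_max K20 orbT.
have e0 : e <= 0 by rewrite /e; lra.
have scale (u v : R) : 0 < u -> 0 < v -> u <= 2 * v -> v `^ e <= B * u `^ e.
  move=> u0 v0 uv.
  have -> : B * u `^ e = (u / 2) `^ e.
    rewrite powRM ?invr_ge0//; last exact: ltW.
    by rewrite -powR_inv1// -powRrM mulN1r mulrC.
  by apply: le0_ler_powR => //; lra.
near=> x.
have xr : r < N x by near: x; exact: near_infinity_gt.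
have xxi : 2 * N xi < N x by near: x; exact: near_infinity_gt.
have x0 : 0 < N x by have := euclid_norm_ge0 R xi; lra.
have y1 : N x <= 2 * N (x - xi) by have := euclid_norm_triangleB R x xi; lra.
have y2 : N (x - xi) <= 2 * N x.
  by have := euclid_norm_triangle R x (- xi); rewrite euclid_normN; lra.
have y0 : 0 < N (x - xi) by lra.
have /andP[h1 h2] := hPhi x xr; rewrite -/e in h1 h2.
have P1 : c / B * N (x - xi) `^ e <= Phi x.
  apply: le_trans h1; rewrite -mulrA ler_pM2l// ler_pdivrMl//.
  exact: scale.
have P2 : Phi x <= C * B * N (x - xi) `^ e.
  by apply: le_trans h2 _; rewrite -mulrA ler_pM2l//; exact: scale.
rewrite -/e powRrM.
have E0 : 0 <= N (x - xi) `^ e by exact: powR_ge0.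
apply/andP; split.
  apply: (@le_trans _ _ (K1 * (N (x - xi) `^ e) `^ a)).
    rewrite ler_wpM2r ?powR_ge0// -[leRHS]invrK lef_pV2 ?posrE ?invr_gt0//.
      by rewrite le_max lexx.
    by rewrite lt_max K20 orbT.
  rewrite /K1 -powRM//; last by rewrite divr_ge0 ?ltW.
  by apply: ge0_ler_powR; rewrite ?nnegrE ?(ltW (Phi0 x))// mulr_ge0// divr_ge0 ?ltW.
apply: (@le_trans _ _ (K2 * (N (x - xi) `^ e) `^ a)).
  rewrite /K2 -powRM//; last by rewrite mulr_ge0 ?ltW.
  by apply: ge0_ler_powR; rewrite ?nnegrE ?(ltW (Phi0 x))// mulr_ge0// mulr_ge0 ?ltW.
by rewrite ler_wpM2r ?powR_ge0// le_max lexx orbT.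
Unshelve. all: by end_near. Qed.

Lemma fundamental_powR_bounds (xi : lattice d) (a : R) :
  exists2 K, 0 < K & \forall x \near at_infinity R d,
    K^-1 * N (x - xi) `^ ((2 - d%:R) * a) <= Phi x `^ a <=
    K * N (x - xi) `^ ((2 - d%:R) * a).
Proof.
have [a0|a0] := leP 0 a; first exact: fundamental_powR_bounds_ge0.
have na : 0 <= - a by rewrite oppr_ge0 ltW.
have [K K0 hK] := fundamental_powR_bounds_ge0 xi na; exists K => //.
near=> x.
have y0 : 0 < N (x - xi).
  by near: x; exact: (near_infinity_shift xi (near_infinity_gt d 0)).
have : K^-1 * N (x - xi) `^ ((2 - d%:R) * - a) <= Phi x `^ (- a) <=
    K * N (x - xi) `^ ((2 - d%:R) * - a) by near: x.
have n0 : 0 < N (x - xi) `^ ((2 - d%:R) * a) by exact: powR_gt0.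
have p0 : 0 < Phi x `^ a by exact: powR_gt0.
rewrite mulrN !powRN -invfM => /andP[h1 h2]; apply/andP; split.
  by rewrite -lef_pV2 ?posrE ?mulr_gt0 ?invr_gt0// invfM invrK.
by rewrite -lef_pV2 ?posrE ?mulr_gt0.
Unshelve. all: by end_near. Qed.

Lemma fundamental_solution_global_bound : exists2 C, 0 < C &
  forall x, Phi x <= C * (1 + N x) `^ (2 - d%:R).
Proof.
have [c [C [r [c0 C0 hPhi]]]] := fundamental_solution_bounds d3 Phi_fund.
have d3R : 3 <= d%:R :> R by rewrite ler_nat.
apply: (@near_infinity_bound _ _ _ _ (C * 2^-1 `^ (2 - d%:R))).
  by move=> x; rewrite powR_gt0// ltr_pwDl// euclid_norm_ge0.
near=> x.
have xr : r < N x by near: x; exact: near_infinity_gt.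
have x1 : 1 < N x by near: x; exact: near_infinity_gt.
have /andP[_ h] := hPhi x xr; apply: le_trans h _.
rewrite -mulrA ler_pM2l// -powRM ?invr_ge0//; last lra.
by apply: le0_ler_powR; lra.
Unshelve. all: by end_near. Qed.

Lemma fundamental_power_bounds (xi : lattice d) (a b K1 K2 : R) u :
  0 < K1 -> 0 < K2 ->
  (\forall x \near at_infinity R d, Phi x `^ a <= K1 * u x) ->
  (\forall x \near at_infinity R d, u x <= K2 * Phi x `^ b) ->
  exists2 C : R, 1 <= C & power_lower_bound xi ((2 - d%:R) * a) C u /\
    power_upper_bound xi ((2 - d%:R) * b) C u.
Proof.
move=> K10 K20 lo up.
have [k1 k10 hk1] := fundamental_powR_bounds xi a.
have [k2 k20 hk2] := fundamental_powR_bounds xi b.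
pose C := Num.max 1 (Num.max (K1 * k1) (K2 * k2)).
have C1 : 1 <= C by rewrite le_max lexx.
have C0 : 0 < C by exact: lt_le_trans C1.
exists C => //; split; apply: near_infinity_centered.
  apply: filterS2 lo hk1 => x h /andP[h1 _].
  rewrite ler_pdivrMl//; have u0 : 0 <= u x.
    by rewrite -(pmulr_rge0 _ K10); apply: le_trans h; exact: powR_ge0.
  apply: (@le_trans _ _ (K1 * k1 * u x)); last first.
    by rewrite ler_wpM2r// !le_max lexx orbT.
  by rewrite [leRHS]mulrAC [leRHS]mulrC -ler_pdivrMl//; exact: le_trans h1 h.
apply: filterS2 up hk2 => x h /andP[_ h2]; apply: le_trans h _.
apply: (@le_trans _ _ (K2 * k2 * N (x - xi) `^ ((2 - d%:R) * b))).
  by rewrite -mulrA ler_pM2l.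
by rewrite ler_wpM2r ?powR_ge0// !le_max lexx !orbT.
Qed.

Lemma power_upper_bound_fundamental (xi : lattice d) (a C : R) u :
  0 < C -> power_upper_bound xi ((2 - d%:R) * a) C u ->
  exists2 K, 0 < K & \forall x \near at_infinity R d, u x <= K * Phi x `^ a.
Proof.
move=> C0 [M hM]; have [k k0 hk] := fundamental_powR_bounds xi a.
exists (C * k); first exact: mulr_gt0.
have Moo : \forall x \near at_infinity R d, M < N (x - xi).
  exact: (near_infinity_shift xi (near_infinity_gt d M)).
apply: filterS2 Moo hk => x /hM h /andP[h1 _]; apply: le_trans h _.
by rewrite -mulrA ler_pM2l// -ler_pdivrMl.
Qed.

End fundamental_solution_powers.

(** * The Green kernel of the Hardy operator *)

Section hardy_green.
Context (R : realType) (d : nat) (Phi : lattice d -> R) (mu : R)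
  (H0 : lattice d -> R).
Hypotheses (d3 : (3 <= d)%N) (Phi_fund : fundamental_solution Phi).
Local Notation N := (euclid_norm R).
Local Notation Hbar := (hardy_potential Phi).
Local Notation L := (hardy_operator mu H0).
Local Notation V := (fun x => mu * H0 x).
Local Notation G := (green V).
Hypotheses (mu_ge : -1 <= mu) (H0_bounds : forall x, 0 <= H0 x <= Hbar x).
(** Says that L_mu (Phi^(1/2)) is positive at the origin, the strictness from which a source at any
    [xi] is obtained. *)
Hypothesis Hbar_strict : 0 < Hbar 0 + mu * H0 0.

Let d0 : (0 < d)%N. Proof. exact: leq_trans d3. Qed.
Let Phi0 := fundamental_solution_gt0 d3 Phi_fund.
Let s x := Num.sqrt (Phi x).
Let s0 x : 0 < s x. Proof. by rewrite sqrtr_gt0. Qed.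

Let LsE x : L s x = (Hbar x + mu * H0 x) * s x.
Proof.
rewrite /hardy_operator mulrDl; congr (_ + _).
by rewrite /hardy_potential mulfVK // gt_eqF //; exact: s0.
Qed.

Let Ls x : 0 <= L s x.
Proof.
rewrite LsE; apply: mulr_ge0; last exact: ltW.
by have /andP[h1 h2] := H0_bounds x; move: mu_ge => m1; nra.
Qed.

Let exS xi : exists v, supersolution V xi v.
Proof.
by apply: (exists_supersolution (z := 0) xi s0 Ls); rewrite [ltRHS]LsE mulr_gt0.
Qed.

Let coef_gt0 x : 0 < (d * 2)%:R + V x.
Proof. exact: (supersolution_coef_gt0 s0 d0 Ls). Qed.

Lemma hardy_green_solves xi x : L (G ^~ xi) x = delta R xi x.
Proof. exact: (green_solves coef_gt0 (exS xi)). Qed.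

Lemma hardy_green_gt0 xi x : 0 < G x xi.
Proof.
exact: (supersolution_gt0 coef_gt0 (green_supersolution coef_gt0 (exS xi))).
Qed.

Lemma hardy_green_le xi u : (forall x, 0 <= u x) ->
  (forall x, delta R xi x <= L u x) -> forall x, G x xi <= u x.
Proof. by move=> u0 Lu; apply: green_le. Qed.

Lemma hardy_green_minimal xi : minimal_positive_solution mu H0 xi (G ^~ xi).
Proof.
split=> [|v [[Lv v0] _]]; last by apply: hardy_green_le => // x; rewrite Lv.
split; last exact: hardy_green_gt0.
by split=> x; [exact: hardy_green_solves|exact/ltW/hardy_green_gt0].
Qed.

(** For [0 <= mu] the potential is nonnegative, so the translate of [Phi] to [xi] is a
    supersolution; this makes the constant independent of [xi]. *)
Lemma hardy_green_bound : 0 <= mu -> exists2 C, 0 < C & forall x xi,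
  G x xi <= C * (1 + N (x - xi)) `^ (2 - d%:R).
Proof.
move=> mu0; have [C C0 hC] := fundamental_solution_global_bound d3 Phi_fund.
exists C => // x xi; apply: le_trans (hC (x - xi)).
apply: (@hardy_green_le xi (fun y => Phi (y - xi))) => [y|y]; first exact: ltW.
rewrite /hardy_operator laplacian_shift (proj1 Phi_fund) /delta subr_eq0.
by rewrite lerDl !mulr_ge0// ?(ltW (Phi0 _))//; have /andP[] := H0_bounds y.
Qed.

Let alpha : R := (1 + Num.sqrt (1 + mu)) / 2.
Let root := Num.sqrt (1 + mu).
Let q (p : R) := 4 * p * (1 - p) + mu.

Let root_ge0 : 0 <= root. Proof. exact: sqrtr_ge0. Qed.
Let root_sqr : root ^+ 2 = 1 + mu.
Proof. by rewrite sqr_sqrtr// -(subrr 1) lerD2l. Qed.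
(** The other zero of [q] is [alpha - root]: [q] is negative above [alpha] and positive between the
    zeros. This is the origin of the range allowed for theta. *)
Let q_alpha eta : q (alpha + eta) = - 4 * eta * (root + eta).
Proof.
have muE : mu = root ^+ 2 - 1 by rewrite root_sqr addrC addKr.
by rewrite /q [X in _ + X]muE /alpha -/root; field.
Qed.
Let alpha_ge : 2^-1 <= alpha.
Proof. by have := root_ge0; rewrite /alpha -/root => ?; lra. Qed.

Lemma tau_minusE : tau_minus d mu = (2 - d%:R) * alpha.
Proof. by rewrite /tau_minus /alpha; field. Qed.

Lemma tau_gapE : tau_plus d mu - tau_minus d mu = (d%:R - 2) * root.
Proof. by rewrite /tau_minus /tau_plus -/root; field. Qed.

Let Hbar_ge0 x : 0 <= Hbar x.
Proof. by have /andP[h1 h2] := H0_bounds x; exact: le_trans h1 h2. Qed.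

(** The relative deviation [e] of [H0] from [Hbar] may depend on [x]: it is constant under (a) and a
    multiple of |x|^-eps0 under (b). *)
Lemma hardy_powR (P : R) : exists2 C, 0 < C & \forall x \near at_infinity R d,
  forall p e, `|p| <= P -> Hbar x - H0 x <= e * Hbar x ->
  `|L (fun y => Phi y `^ p) x - q p * Hbar x * Phi x `^ p| <=
  (C / N x + `|mu| * e) * Hbar x * Phi x `^ p.
Proof.
have [C C0 hC] := powR_hardy_potential d3 Phi_fund P; exists C => //.
apply: filterS hC => x hx p e /hx {}hx He.
rewrite /hardy_operator (_ : _ - _ =
  (- laplacian (fun y => Phi y `^ p) x - 4 * p * (1 - p) * Hbar x * Phi x `^ p)
  - mu * (Hbar x - H0 x) * Phi x `^ p); last by rewrite /q; ring.
apply: le_trans (ler_normB _ _) _.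
rewrite [leRHS](_ : _ = C / N x * Hbar x * Phi x `^ p +
  `|mu| * (e * Hbar x) * Phi x `^ p); last by ring.
apply: lerD => //.
rewrite !normrM (ger0_norm (powR_ge0 _ _)) ler_wpM2r ?powR_ge0//.
rewrite ler_wpM2l// ger0_norm// subr_ge0.
by have /andP[] := H0_bounds x.
Qed.

Let powR_sqrt_small (K p e : R) : 2^-1 < p -> 0 < K -> 0 < e ->
  \forall x \near at_infinity R d, K * Phi x `^ p <= e * s x.
Proof.
move=> p2 K0 e0.
have p0 : 0 < p - 2^-1 by lra.
apply: filterS (near_infinity_fundamental_powR_le d3 Phi_fund p0 (divr_gt0 e0 K0)) => x.
rewrite ler_pdivlMr// => h; have x0 := Phi0 x.
have -> : Phi x `^ p = Phi x `^ (p - 2^-1) * s x.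
  rewrite /s -powR12_sqrt ?ltW// -powRD ?subrK//.
  by apply/implyP => _; rewrite gt_eqF.
by rewrite mulrA ler_wpM2r ?(ltW (s0 x))// mulrC.
Qed.

Lemma hardy_green_unique_powR (xi : lattice d) u (K p : R) :
  (forall x, L u x = delta R xi x) -> 2^-1 < p -> 0 < K ->
  (\forall x \near at_infinity R d, u x <= K * Phi x `^ p) ->
  forall x, u x <= G x xi.
Proof.
move=> Lu p2 K0 uK.
(* With radius -1 the ball is empty and the comparison is global. *)
apply: (@exterior_comparison _ _ V s u (G ^~ xi) (-1) d0 s0 Ls) => [x|x _|x|e e0].
- by move=> h; have := euclid_norm_ge0 R x; move: h; lra.
- rewrite le_eqVlt; apply/orP; left; apply/eqP.
  by rewrite [LHS]Lu [RHS]hardy_green_solves.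
- exact/ltW/hardy_green_gt0.
- apply: filterS2 uK (powR_sqrt_small p2 K0 e0) => x; exact: le_trans.
Qed.

(* If [u <= K G] then [G - (u - G) / K] is a nonnegative solution, hence is
   at least [G] by minimality. *)
Lemma hardy_green_unique_green (xi : lattice d) u (K : R) :
  (forall x, L u x = delta R xi x) ->
  (\forall x \near at_infinity R d, u x <= K * G x xi) ->
  forall x, u x <= G x xi.
Proof.
move=> Lu uK x.
have [{}K K0 {}uK] := near_infinity_bound (hardy_green_gt0 xi) uK.
pose v y := (1 + K^-1) * G y xi + - K^-1 * u y.
have : G x xi <= v x.
  apply: hardy_green_le => [y|y].
    have := uK y; rewrite -ler_pdivrMl// /v => h.
    have Gy := hardy_green_gt0 xi y; have Ki : 0 < K^-1 by rewrite invr_gt0.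
    have : 0 <= K^-1 * G y xi by rewrite mulr_ge0// ltW.
    by move: h; lra.
  have -> : L v y = (1 + K^-1) * L (G ^~ xi) y + L (fun y => - K^-1 * u y) y.
    exact: (@schrodinger_linear _ _ V _ (G ^~ xi) (fun y => - K^-1 * u y)).
  have -> : L (fun y => - K^-1 * u y) y = - K^-1 * L u y by exact: (@schrodingerZ _ _ V).
  rewrite hardy_green_solves Lu; lra.
rewrite /v mulrDl mul1r mulNr -addrA lerDl subr_ge0 ler_pM2l//.
by rewrite invr_gt0.
Qed.

Section power_barriers.
Variable xi : lattice d.

Section potential_limit.
Hypothesis H0_a : forall e, 0 < e ->
  \forall x \near at_infinity R d, Hbar x - H0 x <= e * Hbar x.

Let hardy_powR_a (P e : R) : 0 < e -> \forall x \near at_infinity R d,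
  forall p, `|p| <= P ->
  `|L (fun y => Phi y `^ p) x - q p * Hbar x * Phi x `^ p| <=
  e * (Hbar x * Phi x `^ p).
Proof.
move=> e0; have [C C0 hC] := hardy_powR P.
pose e' := e / 2 / (`|mu| + 1).
have m1 : 0 < `|mu| + 1 by rewrite ltr_wpDl.
have e'0 : 0 < e' by rewrite !divr_gt0.
have Ha := H0_a e'0.
near=> x.
have hx : forall p e, `|p| <= P -> Hbar x - H0 x <= e * Hbar x ->
  `|L (fun y => Phi y `^ p) x - q p * Hbar x * Phi x `^ p| <=
  (C / N x + `|mu| * e) * Hbar x * Phi x `^ p by near: x.
have Hx : Hbar x - H0 x <= e' * Hbar x by near: x.
have x1 : 2 * C / e < N x by near: x; exact: near_infinity_gt.
have x0 : 0 < N x by apply: le_lt_trans x1; rewrite divr_ge0 ?mulr_ge0// ltW.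
move=> p pP; apply: le_trans (hx p e' pP Hx) _.
rewrite -mulrA; apply: ler_wpM2r.
  by apply: mulr_ge0; [exact: Hbar_ge0|exact: powR_ge0].
have h1 : C / N x <= e / 2.
  by rewrite ler_pdivrMr//; move: x1; rewrite ltr_pdivrMr//; lra.
have h2 : `|mu| * e' <= e / 2.
  rewrite /e' mulrCA ger_pMr; last by rewrite divr_gt0.
  by rewrite ler_pdivrMr// mul1r lerDl.
by apply: le_trans (lerD h1 h2) _; rewrite -splitr.
Unshelve. all: by end_near. Qed.

Lemma hardy_green_upper_a (eta : R) : 0 < eta < root ->
  exists2 K, 0 < K &
    \forall x \near at_infinity R d, G x xi <= K * Phi x `^ (alpha - eta).
Proof.
move=> /andP[eta0 etar].
(* This positive value is then taken as the relative error, which leaves [L] of the power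
   nonnegative. *)
have Q0 : 0 < q (alpha + - eta).
  rewrite (_ : q _ = 4 * eta * (root - eta)); last by rewrite q_alpha; ring.
  by rewrite !mulr_gt0// subr_gt0.
have /near_infinityP[M hM] := hardy_powR_a `|alpha - eta| Q0.
have [|||K K0 hK] := green_upper (w := fun x => Phi x `^ (alpha - eta))
    (r := Num.max M (N xi)) coef_gt0 (exS xi).
- by rewrite le_max lexx orbT.
- by move=> x _; exact: powR_gt0.
- move=> x; rewrite gt_max => /andP[/hM/(_ _ (lexx _)) + _].
  rewrite ler_norml => /andP[+ _]; rewrite -/(hardy_operator _ _ _).
  rewrite -mulrA; set w := _ * Phi x `^ _; set l := hardy_operator _ _ _ _.
  rewrite -[X in _ -> _ <= X]/l; lra.
exists K => //; apply/near_infinityP; exists (Num.max M (N xi)); exact: hK.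
Qed.

Lemma hardy_green_lower_a (eta : R) : 0 < eta ->
  exists2 K, 0 < K &
    \forall x \near at_infinity R d, Phi x `^ (alpha + eta) <= K * G x xi.
Proof.
move=> eta0.
have Q0 : 0 < - q (alpha + eta).
  rewrite (_ : - q _ = 4 * eta * (root + eta)); last by rewrite q_alpha; ring.
  by rewrite !mulr_gt0// ltr_wpDl.
have /near_infinityP[M hM] := hardy_powR_a `|alpha + eta| Q0.
have [x _|x _|x Mx|e e0|K K0 hK] := @exterior_domination _ _ V s
    (fun x => Phi x `^ (alpha + eta)) (G ^~ xi) M d0 s0 Ls.
- exact: hardy_green_gt0.
- by rewrite [leRHS]hardy_green_solves ler0n.
- have := hM x Mx _ (lexx _).
  rewrite ler_norml => /andP[_ +].
  rewrite -mulrA; set w := _ * Phi x `^ _; set l := hardy_operator _ _ _ _.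
  rewrite -[X in _ -> X <= _]/l; lra.
- have p2 : 2^-1 < alpha + eta by apply: le_lt_trans alpha_ge _; rewrite ltrDl.
  by apply: filterS (powR_sqrt_small p2 ltr01 e0) => x; rewrite mul1r.
exists K => //; apply/near_infinityP; exists M; exact: hK.
Qed.

End potential_limit.

Section potential_rate.
Variables (eps0 M0 : R).
Hypotheses (eps0_01 : 0 < eps0 < 1) (M0_ge0 : 0 <= M0).
Hypothesis H0_b : \forall x \near at_infinity R d,
  Hbar x - H0 x <= M0 * N x `^ (- eps0) * Hbar x.

Let hardy_powR_b (P : R) : exists2 C, 0 < C & \forall x \near at_infinity R d,
  forall p, `|p| <= P ->
  `|L (fun y => Phi y `^ p) x - q p * Hbar x * Phi x `^ p| <=
  C * N x `^ (- eps0) * (Hbar x * Phi x `^ p).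
Proof.
have [C C0 hC] := hardy_powR P.
have /andP[ep0 ep1] := eps0_01.
exists (C + `|mu| * M0); first by rewrite ltr_wpDr// mulr_ge0.
have Hb := H0_b.
near=> x.
have hx : forall p e, `|p| <= P -> Hbar x - H0 x <= e * Hbar x ->
  `|L (fun y => Phi y `^ p) x - q p * Hbar x * Phi x `^ p| <=
  (C / N x + `|mu| * e) * Hbar x * Phi x `^ p by near: x.
have Hx : Hbar x - H0 x <= M0 * N x `^ (- eps0) * Hbar x by near: x.
have x1 : 1 < N x by near: x; exact: near_infinity_gt.
move=> p pP; apply: le_trans (hx p _ pP Hx) _.
rewrite -mulrA; apply: ler_wpM2r.
  by apply: mulr_ge0; [exact: Hbar_ge0|exact: powR_ge0].
rewrite mulrDl mulrA lerD2r ler_pM2l// -powR_inv1; last lra.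
by rewrite ler_powR ?ltW//; lra.
Unshelve. all: by end_near. Qed.

(** Chosen so that Phi^eps ~ |x|^(- eps0 / 2), which dominates |x|^-eps0. *)
Let eps := eps0 / (2 * (d%:R - 2)).

Let eps_gt0 : 0 < eps.
Proof.
have /andP[ep0 _] := eps0_01; have d3R : 3 <= d%:R :> R by rewrite ler_nat.
by rewrite divr_gt0//; lra.
Qed.

Let norm_powR_small (k : R) : 0 < k ->
  \forall x \near at_infinity R d, N x `^ (- eps0) <= k * Phi x `^ eps.
Proof.
move=> k0; have /andP[ep0 _] := eps0_01.
have d3R : 3 <= d%:R :> R by rewrite ler_nat.
have [K K0 hK] := fundamental_powR_bounds d3 Phi_fund 0 eps.
near=> x.
have x0 : 0 < N x by near: x; exact: near_infinity_gt.
have hx : K^-1 * N (x - 0) `^ ((2 - d%:R) * eps) <= Phi x `^ eps <=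
    K * N (x - 0) `^ ((2 - d%:R) * eps) by near: x.
have /andP[h _] := hx; rewrite subr0 in h.
have e2 : N x `^ (- (eps0 / 2)) <= k / K.
  by near: x; apply: near_infinity_powR_le; rewrite ?divr_gt0// oppr_lt0 divr_gt0.
have E : (2 - d%:R) * eps = - (eps0 / 2).
  by rewrite /eps; field; rewrite gt_eqF//; lra.
rewrite E in h.
have -> : N x `^ (- eps0) = N x `^ (- (eps0 / 2)) * N x `^ (- (eps0 / 2)).
  rewrite -powRD; last by apply/implyP => _; rewrite gt_eqF.
  by congr (_ `^ _); field.
apply: le_trans (ler_wpM2r (powR_ge0 _ _) e2) _.
by rewrite -mulrA ler_pM2l.
Unshelve. all: by end_near. Qed.

Let powR_alphaD (a b : R) x : Phi x `^ (a + b) = Phi x `^ a * Phi x `^ b.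
Proof. by rewrite powRD//; apply/implyP => _; rewrite gt_eqF. Qed.

Let Q := 4 * eps * (root + eps).
Let Q_gt0 : 0 < Q.
Proof. by apply: mulr_gt0; [exact: mulr_gt0|rewrite ltr_wpDl]. Qed.
Let q_eps : q (alpha + eps) = - Q.
Proof. by rewrite q_alpha /Q; ring. Qed.
Let q_alpha0 : q alpha = 0.
Proof. by rewrite -[alpha]addr0 q_alpha; ring. Qed.

(** As q alpha = 0, the sign of L (Phi^alpha) is undetermined. Subtracting Phi^(alpha + eps)
    contributes the positive main term Q Hbar Phi^(alpha + eps). *)
Lemma hardy_green_upper_b :
  exists2 K, 0 < K &
    \forall x \near at_infinity R d, G x xi <= K * Phi x `^ alpha.
Proof.
have a0 : 0 < alpha by apply: lt_le_trans alpha_ge; rewrite invr_gt0.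
have [C C0 hC] := hardy_powR_b (alpha + eps).
pose w x := -1 * Phi x `^ (alpha + eps) + Phi x `^ alpha.
have /near_infinityP[M hM] :
    \forall x \near at_infinity R d, 0 < w x /\ 0 <= L w x.
  near=> x.
  have hx : forall p, `|p| <= alpha + eps ->
    `|L (fun y => Phi y `^ p) x - q p * Hbar x * Phi x `^ p| <=
    C * N x `^ (- eps0) * (Hbar x * Phi x `^ p) by near: x.
  have small : Phi x `^ eps <= 2^-1.
    by near: x; apply: near_infinity_fundamental_powR_le.
  (* With E = Phi^eps <= 1 and c = C |x|^-eps0 this gives c (1 + E) <= Q E, which pays for the
     errors of both powers. *)
  have Nx : N x `^ (- eps0) <= Q / (2 * C) * Phi x `^ eps.
    by near: x; apply: norm_powR_small; rewrite divr_gt0// mulr_gt0.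
  have A0 : 0 < Phi x `^ alpha by exact: powR_gt0.
  have E0 : 0 < Phi x `^ eps by exact: powR_gt0.
  split; first by rewrite /w powR_alphaD; nra.
  have -> : L w x = -1 * L (fun y => Phi y `^ (alpha + eps)) x +
      L (fun y => Phi y `^ alpha) x.
    exact: (@schrodinger_linear _ _ V).
  have := hx (alpha + eps); rewrite ger0_norm; last by rewrite addr_ge0 ?ltW.
  move=> /(_ (lexx _)); rewrite q_eps ler_norml powR_alphaD => /andP[_ h1].
  have := hx alpha; rewrite ger0_norm; last exact: ltW.
  rewrite lerDl ltW// => /(_ isT); rewrite q_alpha0 ler_norml => /andP[h2 _].
  have B0 : 0 <= Hbar x * Phi x `^ alpha.
    by apply: mulr_ge0; [exact: Hbar_ge0|exact: powR_ge0].
  have CN : C * N x `^ (- eps0) <= Q / 2 * Phi x `^ eps.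
    apply: le_trans (ler_wpM2l (ltW C0) Nx) _; rewrite le_eqVlt.
    by apply/orP; left; apply/eqP; field; rewrite gt_eqF.
  have CN0 : 0 <= C * N x `^ (- eps0) by rewrite mulr_ge0 ?powR_ge0// ltW.
  move: B0 h1 h2 small E0 CN CN0; move: (Hbar x) (L _ x) (L _ x) (C * _).
  move: (Phi x `^ alpha) (Phi x `^ eps) => A E h l1 l2 c B0 h1 h2 E2 E00 cE c0.
  have k : 0 <= h * A * (Q * E - c * (1 + E)).
    apply: mulr_ge0 => //; nra.
  nra.
have [|x|x|K K0 hK] := green_upper (w := w) (r := Num.max M (N xi)) coef_gt0 (exS xi).
- by rewrite le_max lexx orbT.
- by rewrite gt_max => /andP[/hM[]].
- by rewrite gt_max => /andP[/hM[]].
exists K => //; apply/near_infinityP; exists (Num.max M (N xi)) => x /hK h.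
apply: le_trans h _; rewrite ler_pM2l// /w gerDr mulN1r oppr_le0.
exact: powR_ge0.
Unshelve. all: by end_near. Qed.

(* [Phi^(alpha + dl) + Phi^(alpha + eps)] is a subsolution outside a ball which
   does not depend on [dl]; taking [dl > 0] makes it negligible against
   [Phi^(1/2)] even when [mu = -1], and [dl] is sent to [0] at the end. *)
Lemma hardy_green_lower_b :
  exists2 K, 0 < K &
    \forall x \near at_infinity R d, Phi x `^ alpha <= K * G x xi.
Proof.
have a0 : 0 < alpha by apply: lt_le_trans alpha_ge; rewrite invr_gt0.
have [C C0 hC] := hardy_powR_b (alpha + eps).
pose u dl x := 1 * Phi x `^ (alpha + dl) + Phi x `^ (alpha + eps).
have /near_infinityP[M hM] : \forall x \near at_infinity R d,
    forall dl, 0 < dl <= eps -> L (u dl) x <= 0.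
  near=> x.
  have hx : forall p, `|p| <= alpha + eps ->
    `|L (fun y => Phi y `^ p) x - q p * Hbar x * Phi x `^ p| <=
    C * N x `^ (- eps0) * (Hbar x * Phi x `^ p) by near: x.
  have small : Phi x `^ eps <= 1.
    by near: x; apply: near_infinity_fundamental_powR_le.
  (* [Phi x <= 1] yields Phi^dl <= 1 for every [dl] at once. *)
  have small1 : Phi x `^ 1 <= 1.
    by near: x; apply: near_infinity_fundamental_powR_le.
  have Nx : N x `^ (- eps0) <= Q / (2 * C) * Phi x `^ eps.
    by near: x; apply: norm_powR_small; rewrite divr_gt0// mulr_gt0.
  move=> dl /andP[dl0 dle].
  have A0 : 0 < Phi x `^ alpha by exact: powR_gt0.
  have E0 : 0 < Phi x `^ eps by exact: powR_gt0.
  have D0 : 0 < Phi x `^ dl by exact: powR_gt0.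
  have D1 : Phi x `^ dl <= 1.
    rewrite powRr1 in small1; last exact: ltW.
    rewrite -[leRHS](powRr0 (Phi x)); apply: ger_powR; last exact: ltW.
    by rewrite Phi0.
  have -> : L (u dl) x = 1 * L (fun y => Phi y `^ (alpha + dl)) x +
      L (fun y => Phi y `^ (alpha + eps)) x.
    exact: (@schrodinger_linear _ _ V).
  have := hx (alpha + eps); rewrite ger0_norm; last by rewrite addr_ge0 ?ltW.
  move=> /(_ (lexx _)); rewrite q_eps ler_norml powR_alphaD => /andP[_ h1].
  have := hx (alpha + dl); rewrite ger0_norm; last by rewrite addr_ge0 ?ltW.
  rewrite lerD2l dle => /(_ isT); rewrite ler_norml powR_alphaD => /andP[_ h2].
  have qdl : q (alpha + dl) <= 0.
    rewrite (_ : q _ = - (4 * dl * (root + dl))); last by rewrite q_alpha; ring.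
    by rewrite oppr_le0 !mulr_ge0// ?addr_ge0// ltW.
  have B0 : 0 <= Hbar x * Phi x `^ alpha.
    by apply: mulr_ge0; [exact: Hbar_ge0|exact: powR_ge0].
  have CN : C * N x `^ (- eps0) <= Q / 2 * Phi x `^ eps.
    apply: le_trans (ler_wpM2l (ltW C0) Nx) _; rewrite le_eqVlt.
    by apply/orP; left; apply/eqP; field; rewrite gt_eqF.
  have CN0 : 0 <= C * N x `^ (- eps0) by rewrite mulr_ge0 ?powR_ge0// ltW.
  move: B0 h1 h2 small E0 D0 D1 CN CN0 qdl.
  move: (Hbar x) (L _ x) (L _ x) (C * _) (q _).
  move: (Phi x `^ alpha) (Phi x `^ eps) (Phi x `^ dl).
  move=> A E D h l1 l2 c qd B0 h1 h2 E2 E00 D00 D2 cE c0 qd0.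
  have k1 : 0 <= h * A * (Q * E - c * (1 + E)).
    apply: mulr_ge0 => //; nra.
  have k2 : qd * D * (h * A) <= 0.
    by rewrite mulr_le0_ge0// mulr_le0_ge0// ltW.
  have k3 : D * (c * (h * A)) <= c * (h * A).
    by apply: ler_piMl => //; exact: mulr_ge0.
  nra.
(* Bounding both powers by (1 + Phi)^(alpha + eps) makes [K] independent of [dl]. *)
have [K K0 hK] := finite_bound
  (fun x => 2 * (1 + Phi x) `^ (alpha + eps) / G x xi) (@finite_ball R d M).
have uG dl : 0 < dl <= eps -> forall x, u dl x <= K * G x xi.
  move=> dlP; have /andP[dl0 dle] := dlP.
  apply: (@exterior_comparison _ _ V s _ (fun x => K * G x xi) M d0 s0 Ls)
    => [x xM|x Mx|x|e e0].
  - have := hK x xM; rewrite ler_pdivrMr ?hardy_green_gt0//; apply: le_trans.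
    have P1 p : 0 <= p <= alpha + eps -> Phi x `^ p <= (1 + Phi x) `^ (alpha + eps).
      move=> /andP[p0 pa]; apply: (@le_trans _ _ ((1 + Phi x) `^ p)).
        by apply: ge0_ler_powR => //; rewrite ?nnegrE ?addr_ge0 ?ltW// ltrDr.
      by apply: ler_powR => //; rewrite lerDl ltW.
    by rewrite /u mul1r mulr_natl mulr2n lerD//;
      rewrite P1 ?lexx ?andbT ?lerD2l ?dle ?andbT ?addr_ge0 ?ltW.
  - apply: (@le_trans _ _ 0); first exact: hM.
    rewrite schrodingerZ mulr_ge0 ?(ltW K0)//.
    by rewrite [leRHS]hardy_green_solves ler0n.
  - by rewrite mulr_ge0 ?(ltW K0)// ltW// hardy_green_gt0.
  - have e2 : 0 < e / 2 by rewrite divr_gt0.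
    have p1 : 2^-1 < alpha + dl by apply: le_lt_trans alpha_ge _; rewrite ltrDl.
    have p2 : 2^-1 < alpha + eps by apply: le_lt_trans alpha_ge _; rewrite ltrDl.
    apply: filterS2 (powR_sqrt_small p1 ltr01 e2) (powR_sqrt_small p2 ltr01 e2) => x.
    by rewrite /u; lra.
exists K => //; apply/near_infinityP; exists 0 => x _.
have A0 : 0 < Phi x `^ alpha by exact: powR_gt0.
rewrite leNgt; apply/negP => KG.
pose y := K * G x xi / Phi x `^ alpha.
have y1 : y < 1 by rewrite ltr_pdivrMr// mul1r.
(* Since Phi^dl >= 1 + dl ln Phi > 1 - dl l, a [dl] with [dl * l <= 1 - y] gives Phi^dl > y, against
   [uG]. *)
pose l := `|ln (Phi x)| + 1; have l0 : 0 < l by rewrite ltr_wpDl.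
pose dl := Num.min eps ((1 - y) / l).
have dl0 : 0 < dl by rewrite lt_min eps_gt0 divr_gt0// subr_gt0.
have /uG/(_ x) : 0 < dl <= eps by rewrite dl0 ge_min lexx.
apply/negP; rewrite -ltNge.
apply: (@lt_le_trans _ _ (Phi x `^ (alpha + dl))); last first.
  by rewrite /u mul1r lerDl powR_ge0.
rewrite powR_alphaD [ltRHS]mulrC -ltr_pdivrMr// -/y.
apply: (@lt_le_trans _ _ (1 + dl * ln (Phi x))).
  have dll : dl * l <= 1 - y.
    by rewrite -ler_pdivlMr// ge_min lexx orbT.
  have : - l < ln (Phi x).
    by rewrite ltrNl (le_lt_trans (ler_norm _))// normrN ltrDl.
  move=> lL; have : 0 < dl * (ln (Phi x) + l).
    by apply: mulr_gt0 => //; rewrite -(opprK l) subr_gt0.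
  by rewrite mulrDr; move: dll; clearbody dl l y; lra.
by rewrite /powR gt_eqF//; exact: expR_ge1Dx.
Unshelve. all: by end_near. Qed.

End potential_rate.
End power_barriers.

Lemma tau_minusDr theta :
  tau_minus d mu + theta = (2 - d%:R) * (alpha - theta / (d%:R - 2)).
Proof.
have d3R : 3 <= d%:R :> R by rewrite ler_nat.
by rewrite tau_minusE; field; rewrite gt_eqF//; lra.
Qed.

Section green_asymptotics.
Variable xi : lattice d.

Lemma hardy_green_asymptotics_a :
  (forall e, 0 < e -> \forall x \near at_infinity R d, Hbar x - H0 x <= e * Hbar x) ->
  forall theta, 0 < theta < tau_plus d mu - tau_minus d mu ->
  exists2 C : R, 1 <= C &
    power_lower_bound xi (tau_minus d mu - theta) C (G ^~ xi) /\
    power_upper_bound xi (tau_minus d mu + theta) C (G ^~ xi).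
Proof.
move=> H0_a theta; rewrite tau_gapE => /andP[t0 t1].
have d3R : 3 <= d%:R :> R by rewrite ler_nat.
have d2 : 0 < d%:R - 2 :> R by lra.
pose eta := theta / (d%:R - 2).
have eta0 : 0 < eta by exact: divr_gt0.
have etar : eta < root by rewrite ltr_pdivrMr// mulrC.
have [K1 K10 lo] := hardy_green_lower_a xi H0_a eta0.
have [|K2 K20 up] := hardy_green_upper_a xi H0_a (eta := eta); first by rewrite eta0.
rewrite !tau_minusDr mulNr opprK.
exact: (fundamental_power_bounds d3 Phi_fund xi K10 K20 lo up).
Qed.

Lemma hardy_green_unique_a u : -1 < mu ->
  positive_solution mu H0 xi u -> upper_bound_a mu xi u -> u = G ^~ xi.
Proof.
move=> mu1 uP uub; have [[Lu u0] _] := uP.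
have d3R : 3 <= d%:R :> R by rewrite ler_nat.
have d2 : 0 < d%:R - 2 :> R by lra.
have root0 : 0 < root by rewrite sqrtr_gt0; lra.
(* This theta yields the exponent alpha - root / 4 = 1/2 + root / 4, above the threshold 1/2. *)
have [|C C1] := uub ((d%:R - 2) * (root / 4)).
  rewrite tau_gapE; apply/andP; split; first by rewrite !mulr_gt0.
  by rewrite ltr_pM2l//; lra.
rewrite tau_minusDr (_ : _ / _ = root / 4); last by field; rewrite gt_eqF.
have pE : alpha - root / 4 = 2^-1 + root / 4 by rewrite /alpha -/root; field.
rewrite pE => /(power_upper_bound_fundamental d3 Phi_fund)[|K K0 uK].
  exact: lt_le_trans C1.
apply/funext => x; apply/le_anti.
rewrite (hardy_green_unique_powR Lu _ K0 uK)/=; last first.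
  by rewrite ltrDl divr_gt0.
by apply: hardy_green_le => // y; rewrite Lu.
Qed.

Section potential_rate_asymptotics.
Variables (eps0 M0 : R).
Hypotheses (eps0_01 : 0 < eps0 < 1) (M0_ge0 : 0 <= M0).
Hypothesis H0_b : \forall x \near at_infinity R d,
  Hbar x - H0 x <= M0 * N x `^ (- eps0) * Hbar x.

Lemma hardy_green_asymptotics_b :
  exists2 C : R, 1 <= C &
    power_lower_bound xi (tau_minus d mu) C (G ^~ xi) /\
    power_upper_bound xi (tau_minus d mu) C (G ^~ xi).
Proof.
have [K1 K10 lo] := hardy_green_lower_b xi eps0_01 M0_ge0 H0_b.
have [K2 K20 up] := hardy_green_upper_b xi eps0_01 M0_ge0 H0_b.
rewrite tau_minusE.
exact: (fundamental_power_bounds d3 Phi_fund xi K10 K20 lo up).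
Qed.

(** The lower bound on [G] converts the upper bound on [u] into [u <= K * K1 * G] near infinity, an
    argument that still works when alpha = 1/2. *)
Lemma hardy_green_unique_b u :
  positive_solution mu H0 xi u -> upper_bound_b mu xi u -> u = G ^~ xi.
Proof.
move=> [[Lu u0] _] [C C1]; rewrite tau_minusE.
move=> /(power_upper_bound_fundamental d3 Phi_fund (lt_le_trans ltr01 C1))[K K0 uK].
have [K1 K10 lo] := hardy_green_lower_b xi eps0_01 M0_ge0 H0_b.
have {}uK : \forall x \near at_infinity R d, u x <= K * K1 * G x xi.
  by apply: filterS2 uK lo => x h1 h2; apply: le_trans h1 _; rewrite -mulrA ler_pM2l.
apply/funext => x; apply/le_anti; rewrite (hardy_green_unique_green Lu uK)/=.
by apply: hardy_green_le => // y; rewrite Lu.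
Qed.

End potential_rate_asymptotics.
End green_asymptotics.

End hardy_green.

(** * The assumptions on [H0] near infinity *)

Section assumptions.
Context (R : realType) (d : nat) (Hbar : lattice d -> R) (mu : R)
  (H0 : lattice d -> R).

Lemma assumption_a_near : assumption_a Hbar mu H0 -> forall e, 0 < e ->
  \forall x \near at_infinity R d, Hbar x - H0 x <= e * Hbar x.
Proof.
move=> [_ H0H /cvgrPdist_le H1] e /H1; apply: filterS => x h.
have /andP[h0 h1] := H0H x; have hb := le_trans h0 h1.
(* Where [Hbar x = 0] the quotient is 0 by convention; the claim is then just [0 <= H0 x]. *)
have [Hb|Hb] := eqVneq (Hbar x) 0.
  by move: h0; rewrite Hb mulr0 sub0r oppr_le0.
have {Hb hb}Hb : 0 < Hbar x by rewrite lt_def Hb.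
rewrite -ler_pdivrMr// mulrBl divff ?gt_eqF//.
exact: le_trans (ler_norm _) h.
Qed.

Lemma assumption_b_near : assumption_b Hbar mu H0 ->
  exists eps0 M0 : R, [/\ 0 < eps0 < 1, 0 <= M0 &
    \forall x \near at_infinity R d,
      Hbar x - H0 x <= M0 * euclid_norm R x `^ (- eps0) * Hbar x].
Proof.
move=> [_ H0H [eps0 e01 /andP[_ lim]] _].
(* A limsup below [+oo] gives a neighbourhood [A] whose supremum is below [+oo]; the absolute value
   of its real part serves as [M0]. *)
have [_ [A Aoo <-] supA] := ereal_inf_lt lim.
pose S := ereal_sup
  [set ((Hbar x - H0 x) * euclid_norm R x `^ eps0 / Hbar x)%:E | x in A].
exists eps0, (`|fine S|); split => //.
near=> x.
have Ax : A x by near: x.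
have x0 : 0 < euclid_norm R x by near: x; exact: near_infinity_gt.
have /andP[h0 h1] := H0H x; have hb := le_trans h0 h1.
have [Hb|Hb] := eqVneq (Hbar x) 0.
  by move: h0; rewrite Hb mulr0 sub0r oppr_le0.
have {Hb hb}Hb : 0 < Hbar x by rewrite lt_def Hb.
have : (((Hbar x - H0 x) * euclid_norm R x `^ eps0 / Hbar x)%:E <= S)%E.
  by apply: ereal_sup_ubound; exists x.
move: supA; rewrite -/S; case: S => [r _|//|//]; rewrite lee_fin /=.
rewrite ler_pdivrMr// => h.
rewrite powRN mulrAC ler_pdivlMr ?powR_gt0//; apply: le_trans h _.
by rewrite ler_pM2r//; exact: ler_norm.
Unshelve. all: by end_near. Qed.

End assumptions.

Lemma hardy_potential0_gt0 (R : realType) (d : nat) (Phi : lattice d -> R) :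
  (3 <= d)%N -> fundamental_solution Phi -> 0 < hardy_potential Phi 0.
Proof.
move=> d3 Phi_fund; have P0 := fundamental_solution_gt0 d3 Phi_fund.
apply: lt_le_trans (hardy_potential_ge d3 Phi_fund 0).
by rewrite (proj1 Phi_fund) /delta eqxx divr_gt0// mulr_gt0.
Qed.

Theorem theorem1p1 (R : realType) (d : nat) (Phi : lattice d -> R)
    (mu : R) (H0 : lattice d -> R)
    (d_ge3 : (3 <= d)%N)
    (Phi_fund : fundamental_solution Phi)
    (H0_ab : assumption_a (hardy_potential Phi) mu H0 \/
             assumption_b (hardy_potential Phi) mu H0) :
  exists G : lattice d -> lattice d -> R,
    [/\ forall xi, minimal_positive_solution mu H0 xi (G ^~ xi),
        assumption_a (hardy_potential Phi) mu H0 -> forall xi,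
          (forall theta : R, 0 < theta < tau_plus d mu - tau_minus d mu ->
            exists2 C : R, 1 <= C &
              power_lower_bound xi (tau_minus d mu - theta) C (G ^~ xi) /\
              power_upper_bound xi (tau_minus d mu + theta) C (G ^~ xi)) /\
          (forall u, positive_solution mu H0 xi u ->
            upper_bound_a mu xi u -> u = G ^~ xi),
        assumption_b (hardy_potential Phi) mu H0 -> forall xi,
          (exists2 C : R, 1 <= C &
              power_lower_bound xi (tau_minus d mu) C (G ^~ xi) /\
              power_upper_bound xi (tau_minus d mu) C (G ^~ xi)) /\
          (forall u, positive_solution mu H0 xi u ->
            upper_bound_b mu xi u -> u = G ^~ xi) &
        0 <= mu ->
          exists2 C : R, 0 < C & forall x xi : lattice d,
            G x xi <= C * (1 + euclid_norm R (x - xi)) `^ (2 - d%:R)].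
Proof.
have Hb0 := hardy_potential0_gt0 d_ge3 Phi_fund.
have [mu1 H0H strict] : [/\ -1 <= mu,
    forall x, 0 <= H0 x <= hardy_potential Phi x &
    0 < hardy_potential Phi 0 + mu * H0 0].
  (* If H0 0 > 0 then Hbar + mu H0 >= (1 + mu) H0 > 0 at the origin; otherwise Hbar 0 > 0
     suffices. *)
  have gt_m1 : -1 < mu -> (forall x, 0 <= H0 x <= hardy_potential Phi x) ->
      0 < hardy_potential Phi 0 + mu * H0 0.
    move=> m1 /(_ 0)/andP[]; rewrite le_eqVlt => /predU1P[<-|h0 h1].
      by rewrite mulr0 addr0.
    have : 0 < (mu + 1) * H0 0 by apply: mulr_gt0 => //; lra.
    by rewrite mulrDl mul1r; lra.
  case: H0_ab => [[m1 h _]|[m1 h _ eqm1]].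
    by split => //; [exact: ltW|exact: gt_m1].
  split=> //; move: m1; rewrite le_eqVlt => /predU1P[m1|/gt_m1]; last exact.
  by rewrite -m1 mulN1r subr_gt0 eqm1.
exists (green (fun x => mu * H0 x)); split.
- by move=> xi; exact: (hardy_green_minimal d_ge3 Phi_fund).
- move=> ha xi; have [m1 _ _] := ha; have near_a := assumption_a_near ha.
  split=> [theta|u]; first exact: (hardy_green_asymptotics_a d_ge3 Phi_fund).
  exact: (hardy_green_unique_a d_ge3 Phi_fund).
- move=> hb xi; have [eps0 [M0 [e01 M00 near_b]]] := assumption_b_near hb.
  split=> [|u]; first exact: (hardy_green_asymptotics_b d_ge3 Phi_fund _ _ _ _ e01 M00).
  exact: (hardy_green_unique_b d_ge3 Phi_fund _ _ _ e01 M00).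
- exact: (hardy_green_bound d_ge3 Phi_fund).
Qed.
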